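(* Let $n\ge 2$, let $q\in\Bbbk$ be a primitive $n$-th root of $1$, and let $c,b\in\Bbbk^{\times}$ with $b^n=c$. Let $H=T(q)$ be the Taft Hopf algebra, $A=\langle g\rangle\subseteq G(T(q))$, let $\chi_i\in\widehat{A}$ be the character with $\chi_i(g)=q^i$, and let $V_{\chi_i}=V_i$ be the one-dimensional $\mathcal{A}(1,c)$-module with basis $v_i$ and action $y\cdot v_i=q^i b\,v_i$, $i=0,\dots,n-1$. Then the collection $(\mathcal{A}(1,c),\{V_{\chi_i}\}_{i=0,\dots,n-1})$ is a dynamical datum for $(T(q),A)$.
   Context: $\Bbbk$ is an algebraically closed field of characteristic $0$. **Taft algebra.** $T(q)$ is the algebra generated by $g,x$ with relations $x^n=0$, $g^n=1$, $gx=q\,xg$, and Hopf algebra structure $\Delta(g)=g\otimes g$, $\Delta(x)=1\otimes x+x\otimes g$, $\varepsilon(g)=1$, $\varepsilon(x)=0$, $\mathcal{S}(g)=g^{-1}$, $\mathcal{S}(x)=-xg^{-1}$. **The algebra $\mathcal{A}(1,c)$.** It is the algebra generated by $y$ with relation $y^n=c\cdot 1$, with left $T(q)$-comodule algebra structure $\delta(y)=g^{-1}\otimes y-xg^{-1}\otimes 1$. **Dynamical data.** Let $H$ be a finite-dimensional Hopf algebra over $\Bbbk$ with antipode $\mathcal{S}$ and $A$ a finite abelian group of group-like elements of $H$, with character group $\widehat{A}$. A (finite-dimensional) left $H$-comodule algebra $K$ with coaction $\delta(k)=k_{(-1)}\otimes k_{(0)}$ is $H$-simple if it has no non-trivial two-sided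 ideal $I$ with $\delta(I)\subseteq H\otimes I$; $K^{\mathrm{co}H}=\{k:\delta(k)=1\otimes k\}$. For left $K$-modules $V,W$ the Yan–Zhu stabilizer is $\mathrm{Stab}_K(V,W)=\mathrm{Hom}_K(H^*\otimes V,H^*\otimes W)\cap\mathcal{L}(H^*\otimes\mathrm{Hom}(V,W))$, where $\mathcal{L}(\gamma\otimes T)(\xi\otimes v)=\gamma\xi\otimes T(v)$ and $K$ acts on $H^*\otimes V$ by $k\cdot(\gamma\otimes v)=(k_{(-1)}\rightharpoondown\gamma)\otimes k_{(0)}v$ with $\langle h\rightharpoondown\gamma,t\rangle=\langle\gamma,\mathcal{S}^{-1}(h)t\rangle$. Elements of $H^*\otimes \mathrm{Hom}(V,W)$ are regarded as linear functions $G:H\to\mathrm{Hom}(V,W)$, and $H$ acts by $(h\cdot G)(t)=G(th)$. For $\mu\in\widehat{A}$, $C(\mu)=\{f\in H^*: f(ah)=\mu(a)f(h)\ \forall a\in A,h\in H\}$, an $H$-module via $(h\cdot f)(t)=f(th)$. A dynamical datum for $(H,A)$ is $(K,\{V_\lambda\}_{\lambda\in\widehat{A}})$ where $K$ is an $H$-simple left $H$-comodule algebra, semisimple as an algebra, with $K^{\mathrm{co}H}=\Bbbk$, and $V_\lambda$ are irreducible $K$-modules such that for all $\lambda,\mu\in\widehat{A}$ there are $H$-module isomorphisms $\mathrm{Stab}_K(V_\lambda,V_\mu)\simeq C(\lambda\mu^{-1})$. *)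

(* Defs.v *)
From HB Require Import structures.
From mathcomp Require Import all_boot all_order all_algebra falgebra.
From mathcomp Require Import finmap.

Set Implicit Arguments.
Unset Strict Implicit.
Unset Printing Implicit Defensive.

Import GRing.Theory.
Local Open Scope ring_scope.

Section TensorProducts.
Variable k : fieldType.

(* A tensor of U (x) V is the matrix of its coordinates in the basis           *)
(* (e_i (x) f_j) built from the library's bases e of U and f of V.             *)
Definition tens (U V : vectType k) : vectType k :=
  'M[k]_(\dim {:U}, \dim {:V}).

Definition ptens (U V : vectType k) (u : U) (v : V) : tens U V :=
  \matrix_(i, j) (coord (vbasis {:U}) i u * coord (vbasis {:V}) j v).

(* The linear map U (x) V -> W induced by a bilinear map beta; tlift beta t is *)
(* the Sweedler-style sum of the beta u v when t is the sum of the u (x) v.    *)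
Definition tlift (U V : vectType k) (W : lmodType k) (beta : U -> V -> W)
    (t : tens U V) : W :=
  \sum_i \sum_j
    (t : 'M_(_, _)) i j *: beta (vbasis {:U})`_i (vbasis {:V})`_j.

Lemma tlift_ptens (U V : vectType k) (W : lmodType k) (beta : U -> V -> W) :
    (forall v, linear (beta^~ v)) -> (forall u, linear (beta u)) ->
  forall u v, tlift beta (ptens u v) = beta u v.
Proof.
move=> betal betar u v.
pose bl w := GRing.isLinear.Build k U W *:%R (beta^~ w) (betal w).
pose br w := GRing.isLinear.Build k V W *:%R (beta w) (betar w).
pose Bl w : {linear U -> W} := HB.pack (beta^~ w) (bl w).
pose Br w : {linear V -> W} := HB.pack (beta w) (br w).
rewrite {2}(coord_vbasis (memvf u)) -[RHS]/(Bl v _) linear_sum.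
apply: eq_bigr => i _; rewrite linearZ /= -[beta _ v]/(Br _ v).
rewrite [in RHS](coord_vbasis (memvf v)) linear_sum scaler_sumr.
by apply: eq_bigr => j _; rewrite mxE linearZ scalerA.
Qed.

(* The subspace U' (x) V' of U (x) V. *)
Definition tensv (U V : vectType k) (U' : {vspace U}) (V' : {vspace V}) :
    {vspace tens U V} :=
  <<[seq ptens u v | u <- vbasis U', v <- vbasis V']>>%VS.

(* (a (x) b)(a' (x) b') = aa' (x) bb'. *)
Definition tmul (A B : falgType k) (s t : tens A B) : tens A B :=
  tlift (fun a b => tlift (fun a' b' => ptens (a * a') (b * b')) t) s.

End TensorProducts.

Notation "u \ot v" := (ptens u v) (at level 40, left associativity).

Section HopfAlgebras.
Variables (k : fieldType) (H : falgType k).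

Record hopf_ops := HopfOps {
  comul : 'Hom(H, tens H H);
  counit : 'Hom(H, k^o);
  antipode : 'End(H)
}.

Variable hs : hopf_ops.

Record is_algebra_map (B : falgType k) (C : vectType k) (one : C)
    (mul : C -> C -> C) (f : B -> C) : Prop := IsAlgebraMap {
  algebra_map1 : f 1 = one;
  algebra_mapM : forall a b, f (a * b) = mul (f a) (f b)
}.

Record is_hopf : Prop := IsHopf {
  comul_alg : is_algebra_map (1 \ot 1) (@tmul k H H) (comul hs);
  counit_alg : is_algebra_map (1 : k^o) *%R (counit hs);
  comulA : forall h,
    tlift (fun a b => tlift (fun a1 a2 => a1 \ot (a2 \ot b)) (comul hs a))
      (comul hs h) =
    tlift (fun a b => a \ot comul hs b) (comul hs h);
  counitl : forall h,
    tlift (fun a b => (counit hs a : k) *: b) (comul hs h) = h;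
  counitr : forall h,
    tlift (fun a b => (counit hs b : k) *: a) (comul hs h) = h;
  antipodel : forall h,
    tlift (fun a b => antipode hs a * b) (comul hs h) = (counit hs h : k)%:A;
  antipoder : forall h,
    tlift (fun a b => a * antipode hs b) (comul hs h) = (counit hs h : k)%:A
}.

Record is_grouplike_abelian (A : {fset H}) : Prop := IsGrouplikeAbelian {
  group1 : 1 \in A;
  groupM : forall a b, a \in A -> b \in A -> a * b \in A;
  groupV : forall a, a \in A -> a^-1 \in A;
  group_comm : forall a b, a \in A -> b \in A -> a * b = b * a;
  group_like : forall a, a \in A -> comul hs a = a \ot a /\ counit hs a = 1
}.

Section ComoduleAlgebras.
Variables (K : falgType k) (delta : 'Hom(K, tens H K)).

Record is_comodule_algebra : Prop := IsComoduleAlgebra {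
  coact_alg : is_algebra_map (1 \ot 1) (@tmul k H K) delta;
  coactA : forall a,
    tlift (fun h b => tlift (fun h1 h2 => h1 \ot (h2 \ot b)) (comul hs h))
      (delta a) =
    tlift (fun h b => h \ot delta b) (delta a);
  coact1 : forall a, tlift (fun h b => (counit hs h : k) *: b) (delta a) = a
}.

Definition left_ideal (I : {vspace K}) : Prop :=
  forall a b, b \in I -> a * b \in I.

Definition two_sided_ideal (I : {vspace K}) : Prop :=
  left_ideal I /\ forall a b, a \in I -> a * b \in I.

Definition H_simple : Prop :=
  forall I : {vspace K}, two_sided_ideal I ->
    (forall a, a \in I -> delta a \in tensv {:H} I) ->
  I = 0%VS \/ I = {:K}%VS.

(* The left regular module is completely reducible. *)
Definition semisimple_algebra : Prop :=
  forall I : {vspace K}, left_ideal I ->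
  exists J : {vspace K},
    [/\ left_ideal J, (I + J)%VS = {:K}%VS & (I :&: J)%VS = 0%VS].

Definition trivial_coinvariants : Prop :=
  forall a, delta a = 1 \ot a <-> exists z : k, a = z%:A.

End ComoduleAlgebras.

End HopfAlgebras.

Section Modules.
Variables (k : fieldType) (K : falgType k).

Record kmodule := KModule {
  kmodule_sort :> vectType k;
  mact : 'Hom(K, 'End(kmodule_sort));
  mact1 : forall v, mact 1 v = v;
  mactM : forall a b v, mact (a * b) v = mact a (mact b v)
}.

Definition irreducible_module (V : kmodule) : Prop :=
  {:V}%VS <> 0%VS /\
  forall U : {vspace V}, (forall a v, v \in U -> mact V a v \in U) ->
  U = 0%VS \/ U = {:V}%VS.

End Modules.

Section Stabilizers.
Variables (k : fieldType) (H : falgType k) (hs : hopf_ops H).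

Definition dual : vectType k := 'Hom(H, k^o).

(* The convolution product of H^*. *)
Definition conv (gamma xi : dual) : dual :=
  linfun (fun h => tlift (fun a b => gamma a * xi b : k^o) (comul hs h)).

(* <h -> gamma, t> = <gamma, S^-1(h) t>. *)
Definition dual_lact (h : H) (gamma : dual) : dual :=
  linfun (fun t => gamma ((antipode hs)^-1%VF h * t)).

(* (h . f)(t) = f(th). *)
Definition dual_ract (h : H) (f : dual) : dual := linfun (fun t => f (t * h)).

Variables (K : falgType k) (delta : 'Hom(K, tens H K)).

Definition dtens_act (V : kmodule K) (a : K) (F : tens dual V) : tens dual V :=
  tlift (fun h a0 =>
    tlift (fun gamma v => dual_lact h gamma \ot mact V a0 v) F) (delta a).

Variables V W : kmodule K.

(* L(gamma (x) T)(xi (x) v) = gamma xi (x) T(v). *)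
Definition stabL :
    'Hom(tens dual 'Hom(V, W), 'Hom(tens dual V, tens dual W)) :=
  linfun (fun G => linfun (fun F =>
    tlift (fun gamma (T : 'Hom(V, W)) =>
      tlift (fun xi v => conv gamma xi \ot T v) F) G)).

Definition stab (F : 'Hom(tens dual V, tens dual W)) : Prop :=
  (forall a X, F (dtens_act a X) = dtens_act a (F X)) /\ F \in limg stabL.

(* (h . G)(t) = G(th) when gamma (x) T is read as the map t |-> gamma(t) T.    *)
Definition dtens_ract (h : H) (G : tens dual 'Hom(V, W)) :
    tens dual 'Hom(V, W) :=
  tlift (fun gamma T => dual_ract h gamma \ot T) G.

(* The same action carried to the image of the injective map stabL. *)
Definition stab_act (h : H) (F : 'Hom(tens dual V, tens dual W)) :
    'Hom(tens dual V, tens dual W) :=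
  stabL (dtens_ract h ((stabL^-1)%VF F)).

End Stabilizers.

Section Characters.
Variables (k : fieldType) (H : falgType k) (A : {fset H}).

Definition is_character (chi : {ffun A -> k}) : bool :=
  [forall a : A, (val a == 1) ==> (chi a == 1)] &&
  [forall a : A, forall b : A, forall ab : A,
     (val ab == val a * val b) ==> (chi ab == chi a * chi b)].

Record character := Character {
  char_fun :> {ffun A -> k};
  char_funP : is_character char_fun
}.

Lemma char_div_subproof (lambda mu : character) :
  is_character [ffun a => lambda a / mu a].
Proof.
have /andP[/forallP l1 /forallP lM] := char_funP lambda.
have /andP[/forallP m1 /forallP mM] := char_funP mu.
apply/andP; split; apply/forallP => a.
  apply/implyP => a1; rewrite ffunE.
  by rewrite (eqP (implyP (l1 a) a1)) (eqP (implyP (m1 a) a1)) divr1.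
apply/forallP => b; apply/forallP => ab; apply/implyP => h.
have /eqP e1 := implyP (forallP (forallP (lM a) b) ab) h.
have /eqP e2 := implyP (forallP (forallP (mM a) b) ab) h.
by rewrite !ffunE e1 e2 invfM mulrACA.
Qed.

(* The product of lambda and the inverse of mu. *)
Definition char_div (lambda mu : character) : character :=
  Character (char_div_subproof lambda mu).

Definition char_space (mu : character) (f : dual H) : Prop :=
  forall (a : A) (h : H), f (val a * h) = mu a * f h.

End Characters.

(* P and Q are H-stable and isomorphic as H-modules; a linear isomorphism      *)
(* between the subspaces P and Q is given by an extension Phi to U.            *)
Definition submod_iso (k : fieldType) (H : Type) (U W : vectType k)
    (P : U -> Prop) (actU : H -> U -> U)
    (Q : W -> Prop) (actW : H -> W -> W) : Prop :=
  [/\ forall h u, P u -> P (actU h u),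
      forall h w, Q w -> Q (actW h w) &
      exists Phi : 'Hom(U, W),
        [/\ forall u, P u -> Q (Phi u),
            forall u1 u2, P u1 -> P u2 -> Phi u1 = Phi u2 -> u1 = u2,
            forall w, Q w -> exists2 u, P u & Phi u = w &
            forall h u, P u -> Phi (actU h u) = actW h (Phi u)]].

Record is_dynamical_datum (k : fieldType) (H : falgType k) (hs : hopf_ops H)
    (A : {fset H}) (K : falgType k) (delta : 'Hom(K, tens H K))
    (V : character A -> kmodule K) : Prop := IsDynamicalDatum {
  datum_hopf : is_hopf hs;
  datum_group : is_grouplike_abelian hs A;
  datum_comodule : is_comodule_algebra hs delta;
  datum_simple : H_simple delta;
  datum_semisimple : semisimple_algebra K;
  datum_coinvariants : trivial_coinvariants delta;
  datum_irreducible : forall lambda, irreducible_module (V lambda);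
  datum_stab : forall lambda mu,
    submod_iso (stab hs delta (V := V lambda) (W := V mu))
               (stab_act hs (V := V lambda) (W := V mu))
               (char_space (char_div lambda mu)) (@dual_ract k H)
}.

Section TaftAlgebras.
Variables (k : fieldType) (n : nat) (q : k).

Definition taft_relations (B : algType k) (g x : B) : Prop :=
  [/\ x ^+ n = 0, g ^+ n = 1 & g * x = q *: (x * g)].

(* Universal property of the algebra presented by g, x and the relations.      *)
Definition taft_presentation (H : algType k) (g x : H) : Prop :=
  taft_relations g x /\
  forall (B : algType k) (g' x' : B), taft_relations g' x' ->
  exists f : {lrmorphism H -> B},
    [/\ f g = g', f x = x' &
        forall f' : {lrmorphism H -> B}, f' g = g' -> f' x = x' -> f' =1 f].

Record is_taft (H : falgType k) (hs : hopf_ops H) (g x : H) : Prop := IsTaft {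
  taft_pres : taft_presentation g x;
  taft_comul : is_algebra_map (1 \ot 1) (@tmul k H H) (comul hs);
  taft_comul_g : comul hs g = g \ot g;
  taft_comul_x : comul hs x = 1 \ot x + x \ot g;
  taft_counit : is_algebra_map (1 : k^o) *%R (counit hs);
  taft_counit_g : counit hs g = 1;
  taft_counit_x : counit hs x = 0;
  (* S reverses products. *)
  taft_antipode :
    is_algebra_map 1 (fun a b : H => b * a) (antipode hs);
  taft_antipode_g : antipode hs g = g^-1;
  taft_antipode_x : antipode hs x = - (x * g^-1)
}.

Variable c : k.

(* Universal property of k<y | y^n = c>. *)
Definition A1_presentation (K : algType k) (y : K) : Prop :=
  y ^+ n = c%:A /\
  forall (B : algType k) (y' : B), y' ^+ n = c%:A ->
  exists f : {lrmorphism K -> B},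
    f y = y' /\ forall f' : {lrmorphism K -> B}, f' y = y' -> f' =1 f.

Record is_A1 (H : falgType k) (g x : H) (K : falgType k) (y : K)
    (delta : 'Hom(K, tens H K)) : Prop := IsA1 {
  A1_pres : A1_presentation y;
  A1_coact : is_algebra_map (1 \ot 1) (@tmul k H K) delta;
  A1_coact_y : delta y = g^-1 \ot y - (x * g^-1) \ot 1
}.

End TaftAlgebras.

(* Main.v *)
Require Import Defs.
From HB Require Import structures.
From mathcomp Require Import all_boot all_order all_algebra falgebra.
From mathcomp Require Import finmap.

Set Implicit Arguments.
Unset Strict Implicit.
Unset Printing Implicit Defensive.

Import GRing.Theory.
Local Open Scope ring_scope.

(** The proof works with the generators of [H] and [K] and never with a basis
    of [H]: linear independence is replaced by the n-th roots of unity, which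
    provide algebra maps [H -> k].

    Generators. The universal property forces [H] to be generated by [g], [x]
    and [K] by [y] ([taft_generated], [A1_generated]): the algebra maps through
    the generated subalgebra onto itself, and by uniqueness this composite is
    the identity. Since [delta] and [comul] are multiplicative, every Hopf or
    comodule axiom then only has to be read on [g], [x] and [y]. The antipode
    axioms are not equalities of algebra maps, but they propagate from two
    factors to their product.

    The algebra [K]. For each n-th root of unity [z] there is an algebra map
    [H -> k] sending [g] to the inverse of [z] and [x] to 0; composing it with
    the coaction gives the twist of [K] that multiplies [y ^+ m] by [z ^+ m]
    ([A1_twist]). Summing the twists against a character of Z/n isolates the
    component of degree [m] of an element ([A1_component]). A coinvariant is
    fixed by every twist, hence has degree 0, hence is a scalar. A stable ideal
    is preserved by every twist, hence contains a nonzero multiple of some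
    [y ^+ m] if it is nonzero, and [y] is invertible. Semisimplicity is
    Maschke's argument for the cyclic group generated by [y / b]
    ([A1_semisimple]).

    The stabilizer. Let [y] act by [s] on the line [V] and by [r] on the line
    [W]. Then [Hom(V, W)] is a line, so an operator in the image of [L] is
    convolution by some [gamma] in the dual of [H]. The comultiplications of [g]
    and [x] show that it commutes with [y] exactly when
    [s gamma(t) = r gamma(g t) + gamma(x t)] for all [t] ([stab_pureP]), that is,
    when [gamma] is an eigenvector, of eigenvalue [s / r], of left translation
    by [g + x / r]. On the other side, for [s = chi_i(g) b] and
    [r = chi_j(g) b], the space [C(chi_i / chi_j)] is the eigenspace of the same
    eigenvalue [s / r] for left translation by [g]. A q-exponential [p] in
    [x * g^-1] is invertible and satisfies [(g + x / r) p = p g]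
    ([taft_conjugate_g]), so [gamma |-> gamma(p _)] identifies both eigenspaces.
    Left translations commute with right translations, so this is an
    isomorphism of [H]-modules ([stab_line_iso]). *)

(** * Tensors and bilinear maps *)

(** Unlike [lfunE], this applies when linearity is a hypothesis rather than a
    canonical structure, as for maps defined by nested [tlift]s. *)
Lemma linfunE_of (k : fieldType) (U V : vectType k) (f : U -> V) :
  linear f -> forall u, linfun f u = f u.
Proof.
move=> lf u; pose fm := GRing.isLinear.Build k U V *:%R f lf.
pose F : {linear U -> V} := HB.pack f fm.
by rewrite -[f]/(F : U -> V) lfunE.
Qed.

Section Tensors.
Variable k : fieldType.

Definition bilinear_map (U V : vectType k) (W : lmodType k)
    (beta : U -> V -> W) : Prop :=
  (forall v, linear (beta^~ v)) /\ (forall u, linear (beta u)).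

Lemma tlift_pure (U V : vectType k) (W : lmodType k) (beta : U -> V -> W) :
  bilinear_map beta -> forall u v, tlift beta (u \ot v) = beta u v.
Proof. by case=> bl br; apply: tlift_ptens. Qed.

Fact tlift_is_linear (U V : vectType k) (W : lmodType k) (beta : U -> V -> W) :
  linear (tlift beta).
Proof.
move=> a s t; rewrite /tlift scaler_sumr -big_split /=; apply: eq_bigr => i _.
rewrite scaler_sumr -big_split /=; apply: eq_bigr => j _.
by rewrite !mxE scalerDl scalerA.
Qed.

HB.instance Definition _ (U V : vectType k) (W : lmodType k)
    (beta : U -> V -> W) :=
  GRing.isLinear.Build k (tens U V) W *:%R (tlift beta) (tlift_is_linear beta).

Fact ptens_is_linear (U V : vectType k) (u : U) : linear (@ptens k U V u).
Proof.
by move=> a v w; apply/matrixP => i j; rewrite !mxE linearP mulrDr mulrCA.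
Qed.

HB.instance Definition _ (U V : vectType k) (u : U) :=
  GRing.isLinear.Build k V (tens U V) *:%R (@ptens k U V u)
    (ptens_is_linear u).

Lemma ptens_linearl (U V : vectType k) (v : V) :
  linear ((@ptens k U V)^~ v).
Proof.
by move=> a u w; apply/matrixP => i j; rewrite !mxE linearP mulrDl mulrA.
Qed.

Lemma ptens_bilinear (U V : vectType k) : bilinear_map (@ptens k U V).
Proof. by split=> [v|u]; [apply: ptens_linearl | apply: ptens_is_linear]. Qed.

Section BilinearLeft.
Variables (U V : vectType k) (W : lmodType k) (beta : U -> V -> W).
Hypothesis bb : bilinear_map beta.

Lemma bilinearDl u w v : beta (u + w) v = beta u v + beta w v.
Proof. by have := bb.1 v 1 u w; rewrite !scale1r. Qed.

Lemma bilinear0l v : beta 0 v = 0.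
Proof. by apply: (@addrI _ (beta 0 v)); rewrite -bilinearDl !addr0. Qed.

Lemma bilinearZl a u v : beta (a *: u) v = a *: beta u v.
Proof. by have := bb.1 v a u 0; rewrite bilinear0l !addr0. Qed.

Lemma bilinearNl u v : beta (- u) v = - beta u v.
Proof. by rewrite -(scaleN1r u) bilinearZl scaleN1r. Qed.

End BilinearLeft.

Definition ptensDl (U V : vectType k) := bilinearDl (@ptens_bilinear U V).
Definition ptensZl (U V : vectType k) := bilinearZl (@ptens_bilinear U V).
Definition ptensNl (U V : vectType k) := bilinearNl (@ptens_bilinear U V).
Definition ptens0l (U V : vectType k) := bilinear0l (@ptens_bilinear U V).

Lemma tens_decomp (U V : vectType k) (t : tens U V) :
  t = \sum_i \sum_j
    (t : 'M_(_, _)) i j *: ((vbasis {:U})`_i \ot (vbasis {:V})`_j).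
Proof.
apply/matrixP => i j; rewrite summxE (bigD1 i) //= summxE (bigD1 j) //=.
rewrite !mxE !(coord_free _ _ (basis_free (vbasisP _))) !eqxx !mulr1.
rewrite !big1 ?addr0 // => [i' i'i|j' j'j].
  rewrite summxE big1 // => j' _; rewrite !mxE.
  by rewrite !(coord_free _ _ (basis_free (vbasisP _))) (negPf i'i) mul0r mulr0.
by rewrite !mxE !(coord_free _ _ (basis_free (vbasisP _))) (negPf j'j) !mulr0.
Qed.

(** This takes the place of computations in Sweedler notation: after
    generalizing a coproduct to an arbitrary tensor, it is taken pure. *)
Lemma tens_ind (U V : vectType k) (P : tens U V -> Prop) :
    (forall a s t, P s -> P t -> P (a *: s + t)) ->
    (forall u v, P (u \ot v)) ->
  forall t, P t.
Proof.
move=> Plin Ppure t; rewrite [t]tens_decomp.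
have P0 : P 0 by have := Ppure 0 0; rewrite linear0.
have PD s s' : P s -> P s' -> P (s + s').
  by move=> Ps Ps'; rewrite -[s]scale1r; apply: Plin.
have PZ a s : P s -> P (a *: s).
  by move=> Ps; rewrite -[_ *: _]addr0; apply: Plin.
by apply: big_ind => // i _; apply: big_ind => // j _; apply: PZ.
Qed.

Lemma eq_on_pure (U V : vectType k) (W : lmodType k) (f f' : tens U V -> W) :
    linear f -> linear f' -> (forall u v, f (u \ot v) = f' (u \ot v)) ->
  f =1 f'.
Proof.
move=> lf lf' ff'; apply: tens_ind => [a s t fs ft|]; last exact: ff'.
by rewrite lf lf' fs ft.
Qed.

Lemma eq_tlift (U V : vectType k) (W : lmodType k) (beta beta' : U -> V -> W) :
  (forall u v, beta u v = beta' u v) -> tlift beta =1 tlift beta'.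
Proof.
by move=> e t; apply: eq_bigr => i _; apply: eq_bigr => j _; rewrite e.
Qed.

Lemma tliftZ (U V : vectType k) (W : lmodType k) (beta : U -> V -> W) c t :
  tlift (fun u v => c *: beta u v) t = c *: tlift beta t.
Proof.
rewrite /tlift scaler_sumr; apply: eq_bigr => i _.
by rewrite scaler_sumr; apply: eq_bigr => j _; rewrite !scalerA mulrC.
Qed.

(** For a bilinear map that itself depends linearly on a parameter, as in
    nested applications of [tlift]. *)
Lemma tlift_param_linear (U V X : vectType k) (W : lmodType k)
    (beta : X -> U -> V -> W) :
    (forall u v, linear (fun s => beta s u v)) ->
  forall t, linear (fun s => tlift (beta s) t).
Proof.
move=> lb t a r s; rewrite /tlift scaler_sumr -big_split; apply: eq_bigr => i _.
rewrite scaler_sumr -big_split; apply: eq_bigr => j _ /=.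
by rewrite lb scalerDr !scalerA mulrC.
Qed.

(** The product [tmul] with arbitrary multiplications on both factors. On
    [H (x) (H (x) K)] it is used with [*%R] on the first factor and [tmul] on the
    second. *)
Definition tmulg (U V : vectType k) (mU : U -> U -> U) (mV : V -> V -> V)
    (s t : tens U V) : tens U V :=
  tlift (fun a b => tlift (fun a' b' => mU a a' \ot mV b b') t) s.

Section TensorMultiplication.
Variables (U V : vectType k) (mU : U -> U -> U) (mV : V -> V -> V).
Hypotheses (bU : bilinear_map mU) (bV : bilinear_map mV).

Let inner_bilinear u v :
  bilinear_map (fun (u' : U) (v' : V) => mU u u' \ot mV v v').
Proof.
split=> [w|w] a s t /=; first by rewrite bU.2 ptensDl ptensZl.
by rewrite bV.2 linearP.
Qed.

Let outer_bilinear t :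
  bilinear_map (fun (u : U) (v : V) =>
    tlift (fun u' v' => mU u u' \ot mV v v') t).
Proof.
split=> w; apply: tlift_param_linear => u' v' a s r /=.
  by rewrite bU.1 ptensDl ptensZl.
by rewrite bV.1 linearP.
Qed.

Lemma tmulg_pure u v u' v' :
  tmulg mU mV (u \ot v) (u' \ot v') = mU u u' \ot mV v v'.
Proof. by rewrite /tmulg !tlift_pure. Qed.

Lemma tmulg_bilinear : bilinear_map (tmulg mU mV).
Proof.
split=> [t|s]; first exact: tlift_is_linear.
by apply: tlift_param_linear => u v; apply: tlift_is_linear.
Qed.

(** Both sides are linear in [s] and in [t], so multiplicativity only has to be
    known on pure tensors. *)
Lemma tlift_tmulg (W : vectType k) (mW : W -> W -> W) (beta : U -> V -> W) :
    bilinear_map mW -> bilinear_map beta ->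
    (forall u u' v v',
       beta (mU u u') (mV v v') = mW (beta u v) (beta u' v')) ->
  forall s t, tlift beta (tmulg mU mV s t) = mW (tlift beta s) (tlift beta t).
Proof.
move=> bW bb betaM s t; have [lm rm] := tmulg_bilinear.
elim/tens_ind: s => [a s s' es es'|u v].
  by rewrite lm !(tlift_is_linear beta) es es' bW.1.
elim/tens_ind: t => [a t t' et et'|u' v'].
  by rewrite rm !(tlift_is_linear beta) et et' bW.2.
by rewrite tmulg_pure !tlift_pure.
Qed.

End TensorMultiplication.

Lemma mulr_bilinear (B : falgType k) : bilinear_map (@GRing.mul B).
Proof.
by split=> u a s t /=; rewrite ?mulrDl ?mulrDr -?scalerAl -?scalerAr.
Qed.

Lemma tmul_pure (B C : falgType k) (a a' : B) (b b' : C) :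
  tmul (a \ot b) (a' \ot b') = (a * a') \ot (b * b').
Proof. by apply: tmulg_pure; apply: mulr_bilinear. Qed.

Lemma tmul_bilinear (B C : falgType k) : bilinear_map (@tmul k B C).
Proof. exact: tmulg_bilinear. Qed.

Lemma tlift_tmul (B C : falgType k) (W : vectType k) (mW : W -> W -> W)
    (beta : B -> C -> W) :
    bilinear_map mW -> bilinear_map beta ->
    (forall u u' v v',
       beta (u * u') (v * v') = mW (beta u v) (beta u' v')) ->
  forall s t, tlift beta (tmul s t) = mW (tlift beta s) (tlift beta t).
Proof. by apply: tlift_tmulg; apply: mulr_bilinear. Qed.

End Tensors.

Lemma span_ind (k : fieldType) (U : vectType k) (X : seq U) (P : U -> Prop) :
    P 0 -> (forall c u v, P u -> P v -> P (c *: u + v)) ->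
    (forall u, u \in X -> P u) ->
  forall u, u \in <<X>>%VS -> P u.
Proof.
move=> P0 Plin PX u uX; rewrite (coord_span (X := in_tuple X) uX).
apply: (big_ind P) => // [v w Pv Pw|i _].
  by rewrite -[v]scale1r; apply: Plin.
by rewrite -[_ *: _]addr0; apply: Plin => //; apply: PX; rewrite mem_nth.
Qed.

(** Stability of a subspace under the coaction is exploited by evaluating the
    first tensor factor with a linear form. *)
Lemma tlift_tensv (k : fieldType) (U V W : vectType k) (I : {vspace V}) (J : {vspace W})
    (beta : U -> V -> W) (t : tens U V) :
    bilinear_map beta -> (forall u v, v \in I -> beta u v \in J) ->
  t \in tensv {:U} I -> tlift beta t \in J.
Proof.
move=> bb bJ; move: t; apply: span_ind => [|e s t sJ tJ|].
- by rewrite linear0 mem0v.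
- by rewrite linearP memvD ?memvZ.
- move=> _ /allpairsP[[u v] /= [_ vI ->]].
  by rewrite tlift_pure // bJ // vbasis_mem.
Qed.

Section Generation.
Variables (k : fieldType) (B : falgType k).

Definition generated_by (X : seq B) : Prop := agenv <<X>> = {:B}%VS.

(** The unit of the subalgebra structure is an abstract [algid]; it is 1 because
    the generated subalgebra contains 1, which makes the inclusion unital. *)
Lemma subalgebra_inclusion (X : seq B) :
  exists j : {lrmorphism subvs_of <<<<X>>>>%AS -> B}, j =1 vsval.
Proof.
pose S := <<<<X>>>>%AS; have S1 : algid S = 1.
  by apply/eqP; rewrite algid_eq1 memvE /= sub1_agenv.
have val_lin : linear (vsval : subvs_of S -> B) by move=> c a b; rewrite linearP.
have val_mul : GRing.monoid_morphism (vsval : subvs_of S -> B) by split.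
pose ml := GRing.isLinear.Build k (subvs_of S) B *:%R vsval val_lin.
pose mm := GRing.isMonoidMorphism.Build (subvs_of S) B vsval val_mul.
pose j : {lrmorphism subvs_of S -> B} := HB.pack (vsval : subvs_of S -> B) ml mm.
by exists j.
Qed.

Lemma generated_by_retraction (X : seq B)
    (f : B -> subvs_of <<<<X>>>>%AS) :
  (forall a, vsval (f a) = a) -> generated_by X.
Proof.
move=> fK; apply/eqP; rewrite eqEsubv subvf; apply/subvP => a _.
by rewrite -[a]fK (subvsP (f a)).
Qed.

(** Left multiplication by generators suffices, since the algebra is the sum of
    the powers of the span of [X]. *)
Lemma generated_ind (X : seq B) (P : B -> Prop) :
    generated_by X ->
    (forall c a b, P a -> P b -> P (c *: a + b)) -> P 1 ->
    (forall u a, u \in X -> P a -> P (u * a)) ->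
  forall a, P a.
Proof.
move=> genX Plin P1 PM a.
have P0 : P 0 by rewrite -(addNr 1) -scaleN1r; apply: Plin.
have PD s t : P s -> P t -> P (s + t).
  by move=> Ps Pt; rewrite -[s]scale1r; apply: Plin.
have PZ c s : P s -> P (c *: s).
  by move=> Ps; rewrite -[_ *: _]addr0; apply: Plin.
have PspanM u s : u \in <<X>>%VS -> P s -> P (u * s).
  move=> uX Ps; apply: (span_ind (P := fun v => P (v * s)) _ _ _ uX) => [|c v w Pv Pw|v vX].
  - by rewrite mul0r.
  - by rewrite mulrDl -scalerAl; apply: Plin.
  - exact: PM.
have PX i s : s \in (<<X>> ^+ i)%VS -> P s.
  elim: i s => [|i IHi] s.
    by rewrite expv0 => /vlineP[c ->]; apply: PZ.
  rewrite expvSl unlock; apply: (span_ind (P := P)) => // _ /allpairsP[[u v] /= [uX vX ->]].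
  by apply: PspanM; [|apply: IHi]; apply: vbasis_mem.
have: a \in agenv <<X>> by rewrite genX memvf.
rewrite /agenv => /memv_sumP[v vX ->].
by apply: big_ind => // i _; apply/PX/vX.
Qed.

(** The target product [mul] is arbitrary, so that the target may be a space of
    tensors. *)
Lemma algebra_map_ext (X : seq B) (C : lmodType k) (mul : C -> C -> C)
    (f f' : B -> C) :
    generated_by X -> linear f -> linear f' ->
    (forall a b, f (a * b) = mul (f a) (f b)) ->
    (forall a b, f' (a * b) = mul (f' a) (f' b)) ->
    f 1 = f' 1 -> (forall u, u \in X -> f u = f' u) ->
  f =1 f'.
Proof.
move=> genX lf lf' fM f'M f1 fX; apply: (generated_ind genX) => //.
  by move=> c a b ea eb; rewrite lf lf' ea eb.
by move=> u a uX ea; rewrite fM f'M ea fX.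
Qed.

End Generation.

(** * Comodule and Hopf axioms on generators *)

Section StandardBilinearMaps.
Variables (k : fieldType) (H : falgType k).

Lemma ptens_nested_bilinear (U V W : vectType k) (w : W) :
  bilinear_map (fun (u : U) (v : V) => u \ot (v \ot w)).
Proof.
split=> [v|u] a s t /=; first exact: ptens_linearl.
by rewrite ptens_linearl linearP.
Qed.

Lemma ptens_lfun_bilinear (U V W : vectType k) (f : 'Hom(V, W)) :
  bilinear_map (fun (u : U) v => u \ot f v).
Proof.
by split=> [v|u] a s t /=; [apply: ptens_linearl | rewrite !linearP].
Qed.

Lemma comul_tens_bilinear (U V : vectType k) (f : 'Hom(U, tens U U)) :
  bilinear_map (fun (u : U) (v : V) =>
    tlift (fun u1 u2 => u1 \ot (u2 \ot v)) (f u)).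
Proof.
split=> [v|u]; first by move=> a s t; rewrite linearP linearP.
by apply: tlift_param_linear => u1 u2 a s t; rewrite !linearP.
Qed.

Lemma form_scale_bilinear (U V : vectType k) (e : 'Hom(U, k^o)) :
  bilinear_map (fun u (v : V) => (e u : k) *: v).
Proof. by split=> [v|u] a s t /=; rewrite !linearP // scalerDl scalerA. Qed.

Lemma scale_form_bilinear (U V : vectType k) (e : 'Hom(V, k^o)) :
  bilinear_map (fun (u : U) v => (e v : k) *: u).
Proof. by split=> [v|u] a s t /=; rewrite !linearP // scalerDl scalerA. Qed.

Lemma lfun_mull_mid_bilinear (f : 'End(H)) (w : H) :
  bilinear_map (fun a b => f a * w * b).
Proof.
by split=> v a s t /=; rewrite ?linearP ?mulrDl ?mulrDr -?scalerAl -?scalerAr.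
Qed.

Lemma lfun_mulr_mid_bilinear (f : 'End(H)) (w : H) :
  bilinear_map (fun a b => a * w * f b).
Proof.
by split=> v a s t /=; rewrite ?linearP ?mulrDl ?mulrDr -?scalerAl -?scalerAr.
Qed.

Lemma lfun_mull_bilinear (f : 'End(H)) : bilinear_map (fun a b => f a * b).
Proof.
by split=> v a s t /=; rewrite ?linearP ?mulrDl ?mulrDr -?scalerAl -?scalerAr.
Qed.

Lemma lfun_mulr_bilinear (f : 'End(H)) : bilinear_map (fun a b => a * f b).
Proof.
by split=> v a s t /=; rewrite ?linearP ?mulrDl ?mulrDr -?scalerAl -?scalerAr.
Qed.

End StandardBilinearMaps.

#[local] Hint Resolve mulr_bilinear tmul_bilinear ptens_nested_bilinear
  ptens_lfun_bilinear comul_tens_bilinear form_scale_bilinear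
  scale_form_bilinear lfun_mull_mid_bilinear lfun_mulr_mid_bilinear
  lfun_mull_bilinear lfun_mulr_bilinear : core.

Section ComoduleAlgebraCriteria.
Variables (k : fieldType) (H : falgType k) (hs : hopf_ops H).
Hypothesis comul_algebra_map : is_algebra_map (1 \ot 1) (@tmul k H H) (comul hs).
Hypothesis counit_algebra_map : is_algebra_map (1 : k^o) *%R (counit hs).
Variables (K : falgType k) (delta : 'Hom(K, tens H K)) (X : seq K).
Hypothesis delta_algebra_map : is_algebra_map (1 \ot 1) (@tmul k H K) delta.
Hypothesis genX : generated_by X.

Let mul3_bilinear : bilinear_map (tmulg (@GRing.mul H) (@tmul k H K)).
Proof. by exact: tmulg_bilinear. Qed.

Let mul3_pure (a a' : H) (s s' : tens H K) :
  tmulg (@GRing.mul H) (@tmul k H K) (a \ot s) (a' \ot s') = (a * a') \ot (tmul s s').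
Proof. by apply: tmulg_pure; [exact: mulr_bilinear|exact: tmul_bilinear]. Qed.

(** Both sides are multiplicative in [a], for the product of [H (x) (H (x) K)].
    With [K] equal to [H] and [delta] to [comul hs] this is coassociativity of [H]. *)
Lemma coassociative_on_generators :
    (forall u, u \in X ->
       tlift (fun h b => tlift (fun h1 h2 => h1 \ot (h2 \ot b)) (comul hs h))
         (delta u) = tlift (fun h b => h \ot delta b) (delta u)) ->
  forall a,
    tlift (fun h b => tlift (fun h1 h2 => h1 \ot (h2 \ot b)) (comul hs h))
      (delta a) = tlift (fun h b => h \ot delta b) (delta a).
Proof.
have [[D1 DM] [d1 dM]] := (comul_algebra_map, delta_algebra_map).
move=> coX; apply: (algebra_map_ext (mul := tmulg (@GRing.mul H) (@tmul k H K)) genX) => //.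
- by move=> c a b; rewrite !linearP.
- by move=> c a b; rewrite !linearP.
- move=> a b; rewrite dM; apply: tlift_tmul => // u u' v v'.
  rewrite DM.
  have [lm rm] := @tmul_bilinear k H H.
  have [lm3 rm3] := mul3_bilinear.
  move: (comul hs u) (comul hs u') => s t.
  elim/tens_ind: s => [e s s' es es'|h1 h2].
    by rewrite lm !(tlift_is_linear _ e) es es' lm3.
  elim/tens_ind: t => [e t t' et et'|h1' h2'].
    by rewrite rm !(tlift_is_linear _ e) et et' rm3.
  by rewrite tmul_pure !tlift_pure // mul3_pure tmul_pure.
- move=> a b; rewrite dM; apply: tlift_tmul => // u u' v v'.
  by rewrite mul3_pure dM.
- by rewrite d1 !tlift_pure // D1 tlift_pure // d1.
Qed.

Lemma counital_on_generators :
    (forall u, u \in X ->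
       tlift (fun h b => (counit hs h : k) *: b) (delta u) = u) ->
  forall a, tlift (fun h b => (counit hs h : k) *: b) (delta a) = a.
Proof.
have [[e1 eM] [d1 dM]] := (counit_algebra_map, delta_algebra_map).
move=> coX; apply: (algebra_map_ext (mul := *%R) genX) => //.
- by move=> c a b; rewrite !linearP.
- move=> a b; rewrite dM; apply: tlift_tmul => // u u' v v'.
  by rewrite eM -scalerAl -scalerAr scalerA.
- by rewrite d1 tlift_pure // e1 scale1r.
Qed.

End ComoduleAlgebraCriteria.

Section HopfCriteria.
Variables (k : fieldType) (H : falgType k) (hs : hopf_ops H) (X : seq H).
Hypothesis comul_algebra_map : is_algebra_map (1 \ot 1) (@tmul k H H) (comul hs).
Hypothesis counit_algebra_map : is_algebra_map (1 : k^o) *%R (counit hs).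
Hypothesis antipode_antimap :
  is_algebra_map 1 (fun a b : H => b * a) (antipode hs).
Hypothesis genX : generated_by X.

Lemma right_counital_on_generators :
    (forall u, u \in X ->
       tlift (fun a b => (counit hs b : k) *: a) (comul hs u) = u) ->
  forall h, tlift (fun a b => (counit hs b : k) *: a) (comul hs h) = h.
Proof.
have [[e1 eM] [d1 dM]] := (counit_algebra_map, comul_algebra_map).
move=> coX; apply: (algebra_map_ext (mul := *%R) genX) => //.
- by move=> c a b; rewrite !linearP.
- move=> a b; rewrite dM; apply: tlift_tmul => // u u' v v'.
  by rewrite eM -scalerAl -scalerAr scalerA mulrC.
- by rewrite d1 tlift_pure // e1 scale1r.
Qed.

(** [h |-> S(h_1) h_2] is not multiplicative, but its value at [a b] is
    [S(b_1) (S(a_1) a_2) b_2], whose middle factor is a scalar when the axiom holds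
    for [a]; so the axiom passes from [a] and [b] to [a b]. *)
Lemma left_antipode_on_generators :
    (forall u, u \in X ->
       tlift (fun a b => antipode hs a * b) (comul hs u) =
       (counit hs u : k)%:A) ->
  forall h,
    tlift (fun a b => antipode hs a * b) (comul hs h) = (counit hs h : k)%:A.
Proof.
have [[D1 DM] [e1 eM]] := (comul_algebra_map, counit_algebra_map).
have [S1 SM] := antipode_antimap.
have [lm rm] := @tmul_bilinear k H H.
(* The product of the first tensor is computed inside that of the second. *)
have mulE s t : tlift (fun a b => antipode hs a * b) (tmul s t) =
    tlift (fun a b => antipode hs a *
      tlift (fun a b => antipode hs a * b) s * b) t.
  elim/tens_ind: t => [c t t' et et'|u' v'].
    by rewrite rm !(tlift_is_linear _ c) et et'.
  rewrite tlift_pure //; elim/tens_ind: s => [c s s' es es'|u v].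
    by rewrite lm !(tlift_is_linear _ c) es es' mulrDr mulrDl -scalerAr -scalerAl.
  by rewrite tmul_pure !tlift_pure // SM !mulrA.
move=> aX; apply: (generated_ind genX) => [c a b ea eb||u a uX ea].
- by rewrite !linearP /= ea eb scalerDl scalerA.
- by rewrite D1 e1 tlift_pure // S1 mul1r scale1r.
- rewrite DM mulE aX // eM -scalerA -ea -tliftZ; apply: eq_tlift => h1 h2.
  by rewrite -scalerAr mulr1 scalerAl.
Qed.

(** As for the left axiom, with [a_1 (b_1 S(b_2)) S(a_2)]: here the axiom for
    [b] makes the middle factor a scalar. *)
Lemma right_antipode_on_generators :
    (forall u, u \in X ->
       tlift (fun a b => a * antipode hs b) (comul hs u) =
       (counit hs u : k)%:A) ->
  forall h,
    tlift (fun a b => a * antipode hs b) (comul hs h) = (counit hs h : k)%:A.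
Proof.
have [[D1 DM] [e1 eM]] := (comul_algebra_map, counit_algebra_map).
have [S1 SM] := antipode_antimap.
have [lm rm] := @tmul_bilinear k H H.
(* The product of the second tensor is computed inside that of the first. *)
have mulE s t : tlift (fun a b => a * antipode hs b) (tmul s t) =
    tlift (fun a b => a *
      tlift (fun a b => a * antipode hs b) t * antipode hs b) s.
  elim/tens_ind: s => [c s s' es es'|u v].
    by rewrite lm !(tlift_is_linear _ c) es es'.
  rewrite tlift_pure //; elim/tens_ind: t => [c t t' et et'|u' v'].
    by rewrite rm !(tlift_is_linear _ c) et et' mulrDr mulrDl -scalerAr -scalerAl.
  by rewrite tmul_pure !tlift_pure // SM !mulrA.
move=> aX; apply: (generated_ind genX) => [c a b ea eb||u a uX ea].
- by rewrite !linearP /= ea eb scalerDl scalerA.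
- by rewrite D1 e1 tlift_pure // S1 mul1r scale1r.
- rewrite DM mulE ea eM mulrC -scalerA -(aX u) // -tliftZ; apply: eq_tlift => h1 h2.
  by rewrite -scalerAr mulr1 scalerAl.
Qed.

End HopfCriteria.

(** * The Taft algebra and its comodule algebra *)

Section Presentations.
Variables (k : fieldType) (n : nat) (q c : k).

(** The map to the generated subalgebra given by existence, followed by the
    inclusion, is the identity by uniqueness. *)
Lemma taft_generated (H : falgType k) (g x : H) :
  taft_presentation n q g x -> generated_by [:: g; x].
Proof.
move=> [relH univ]; pose X := [:: g; x]; have [j jE] := subalgebra_inclusion X.
have inX u : u \in X -> u \in <<<<X>>>>%AS.
  by move=> uX; apply: (subvP (sub_agenv _)); apply: memv_span.
have gS : g \in X by rewrite inE eqxx.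
have xS : x \in X by rewrite !inE eqxx orbT.
pose g' := Subvs (inX g gS); pose x' := Subvs (inX x xS).
have jg : j g' = g by rewrite jE.
have jx : j x' = x by rewrite jE.
have jI : injective j by move=> u v; rewrite !jE; apply: val_inj.
have rel' : taft_relations n q g' x'.
  have [xn gn gx] := relH; split; apply: jI.
  - by rewrite rmorphXn /= jx xn rmorph0.
  - by rewrite rmorphXn /= jg gn rmorph1.
  - by rewrite linearZ !rmorphM /= jg jx.
have [f [fg fx _]] := univ _ _ _ rel'.
have [f0 [_ _ f0U]] := univ _ _ _ relH.
apply: (@generated_by_retraction _ _ X f) => a; rewrite -jE.
have -> : j (f a) = f0 a by apply: (f0U (j \o f)); rewrite /= ?fg ?fx.
by rewrite -(f0U idfun).
Qed.

Lemma A1_generated (K : falgType k) (y : K) :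
  A1_presentation n c y -> generated_by [:: y].
Proof.
move=> [relK univ]; pose X := [:: y]; have [j jE] := subalgebra_inclusion X.
have yS : y \in <<<<X>>>>%AS.
  by apply: (subvP (sub_agenv _)); rewrite memv_span ?inE.
pose y' := Subvs yS; have jy : j y' = y by rewrite jE.
have jI : injective j by move=> u v; rewrite !jE; apply: val_inj.
have rel' : y' ^+ n = c%:A.
  by apply: jI; rewrite rmorphXn /= jy relK linearZ /= rmorph1.
have [f [fy _]] := univ _ _ rel'.
have [f0 [_ f0U]] := univ _ _ relK.
apply: (@generated_by_retraction _ _ X f) => a; rewrite -jE.
have -> : j (f a) = f0 a by apply: (f0U (j \o f)); rewrite /= fy.
by rewrite -(f0U idfun).
Qed.

End Presentations.

Section Taft.
Variables (k : fieldType) (n : nat) (n_gt1 : (1 < n)%N) (q : k).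
Variables (H : falgType k) (hs : hopf_ops H) (g x : H).
Hypothesis H_taft : is_taft n q hs g x.

Let genH := taft_generated (taft_pres H_taft).

Lemma taft_xn : x ^+ n = 0. Proof. by have [[]] := taft_pres H_taft. Qed.
Lemma taft_gn : g ^+ n = 1. Proof. by have [[]] := taft_pres H_taft. Qed.
Lemma taft_gx : g * x = q *: (x * g).
Proof. by have [[]] := taft_pres H_taft. Qed.

Lemma taft_mulgg : g * g ^+ n.-1 = 1.
Proof. by rewrite -exprS prednK ?taft_gn // ltnW. Qed.

Lemma taft_unitg : g \is a GRing.unit.
Proof.
apply/unitrP; exists (g ^+ n.-1); rewrite taft_mulgg.
by rewrite -exprSr prednK ?taft_gn // ltnW.
Qed.
Hint Resolve taft_unitg : core.

Lemma taft_gV : g^-1 = g ^+ n.-1.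
Proof. by apply: (mulrI taft_unitg); rewrite divrr // taft_mulgg. Qed.

Lemma taft_comul1 : comul hs 1 = 1 \ot 1.
Proof. exact: algebra_map1 (taft_comul H_taft). Qed.
Lemma taft_comulM a b : comul hs (a * b) = tmul (comul hs a) (comul hs b).
Proof. exact: algebra_mapM (taft_comul H_taft) a b. Qed.
Lemma taft_counit1 : counit hs 1 = 1.
Proof. exact: algebra_map1 (taft_counit H_taft). Qed.
Lemma taft_counitM a b : counit hs (a * b) = counit hs a * counit hs b.
Proof. exact: algebra_mapM (taft_counit H_taft) a b. Qed.

Lemma taft_grouplike_exp m :
  comul hs (g ^+ m) = g ^+ m \ot g ^+ m /\ counit hs (g ^+ m) = 1.
Proof.
elim: m => [|m [IHd IHe]]; first by rewrite expr0 taft_comul1 taft_counit1.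
rewrite exprS taft_comulM taft_counitM IHd IHe (taft_comul_g H_taft).
by rewrite (taft_counit_g H_taft) tmul_pure mul1r.
Qed.

Lemma taft_comul_xgV :
  comul hs (x * g^-1) = g^-1 \ot (x * g^-1) + (x * g^-1) \ot 1.
Proof.
rewrite taft_comulM (taft_comul_x H_taft) taft_gV.
have [-> _] := taft_grouplike_exp n.-1.
have [lm _] := @tmul_bilinear k H H.
rewrite -[1 \ot x]scale1r lm scale1r !tmul_pure mul1r taft_mulgg.
by [].
Qed.

Lemma taft_antipode_gV : antipode hs g^-1 = g.
Proof.
have [S1 SM] := taft_antipode H_taft.
have gVU : g^-1 \is a GRing.unit by rewrite unitrV.
apply: (mulIr gVU); rewrite divrr // -{2}(taft_antipode_g H_taft).
by rewrite -SM divrr.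
Qed.

(** The image of the antipode is closed under products and contains
    [g = S(g^-1)] and [x = S(- g^-1 x)], so the antipode is onto; a surjective
    endomorphism of a finite-dimensional space is injective. *)
Lemma taft_antipode_injective : lker (antipode hs) = 0%VS.
Proof.
have [S1 SM] := taft_antipode H_taft.
have Sgx : antipode hs (- (g^-1 * x)) = x.
  rewrite linearN /= SM taft_antipode_gV (taft_antipode_x H_taft).
  by rewrite mulNr opprK divrK.
suff Sfull : limg (antipode hs) = fullv.
  apply/eqP; rewrite -dimv_eq0 -(eqn_add2r (\dim (limg (antipode hs)))).
  by rewrite -{1}[lker _]capfv limg_ker_dim Sfull.
apply/eqP; rewrite eqEsubv subvf; apply/subvP => a _; move: a.
apply: (generated_ind genH) => [e a b aS bS||u a].
- by rewrite memvD ?memvZ.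
- by rewrite -S1 memv_img ?memvf.
- rewrite !inE => /orP[]/eqP-> /memv_imgP[b _ ->].
    by rewrite -{1}taft_antipode_gV -SM memv_img ?memvf.
  by rewrite -{1}Sgx -SM memv_img ?memvf.
Qed.

(** [antipode^-1] is only a one-sided inverse by definition; injectivity makes
    it the composition inverse that occurs in the action of [K] on the dual. *)
Lemma taft_antipode_inv a b :
  antipode hs a = b -> ((antipode hs)^-1)%VF b = a.
Proof. by move=> <-; rewrite lker0_lfunK // taft_antipode_injective. Qed.

Lemma taft_antipode_invM a b :
  ((antipode hs)^-1)%VF (a * b) =
  ((antipode hs)^-1)%VF b * ((antipode hs)^-1)%VF a.
Proof.
have [S1 SM] := taft_antipode H_taft.
have SK h : antipode hs (((antipode hs)^-1)%VF h) = h.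
  by apply: lker0_lfunVK; rewrite taft_antipode_injective.
by apply: taft_antipode_inv; rewrite SM !SK.
Qed.

Lemma taft_is_hopf : is_hopf hs.
Proof.
have [D1 DM] := taft_comul H_taft.
have [e1 eM] := taft_counit H_taft.
have [S1 SM] := taft_antipode H_taft.
have Dg := taft_comul_g H_taft; have Dx := taft_comul_x H_taft.
have eg := taft_counit_g H_taft; have ex := taft_counit_x H_taft.
have Sg := taft_antipode_g H_taft; have Sx := taft_antipode_x H_taft.
have pair (P : H -> Prop) : P g -> P x -> forall u, u \in [:: g; x] -> P u.
  by move=> Pg Px u; rewrite !inE => /orP[]/eqP->.
split; [exact: taft_comul H_taft | exact: taft_counit H_taft | | | | | ].
- apply: (coassociative_on_generators _ _ genH) => //; apply: pair.
    by rewrite Dg !tlift_pure // Dg tlift_pure.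
  rewrite Dx !linearD /= !tlift_pure // D1 Dx Dg !linearD /= !tlift_pure //.
  by rewrite addrA.
- apply: (counital_on_generators _ _ genH) => //; apply: pair.
    by rewrite Dg tlift_pure // eg scale1r.
  by rewrite Dx linearD /= !tlift_pure // e1 ex scale1r scale0r addr0.
- apply: (right_counital_on_generators _ _ genH) => //; apply: pair.
    by rewrite Dg tlift_pure // eg scale1r.
  by rewrite Dx linearD /= !tlift_pure // ex eg scale1r scale0r add0r.
- apply: (left_antipode_on_generators _ _ _ genH) => //; apply: pair.
    by rewrite Dg tlift_pure // Sg mulVr // eg scale1r.
  rewrite Dx linearD /= !tlift_pure // S1 mul1r Sx ex scale0r.
  by rewrite mulNr divrK // subrr.
- apply: (right_antipode_on_generators _ _ _ genH) => //; apply: pair.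
    by rewrite Dg tlift_pure // Sg mulrV // eg scale1r.
  rewrite Dx linearD /= !tlift_pure // mul1r Sx Sg ex scale0r.
  by rewrite addrC subrr.
Qed.

Section PowersOfg.
Variable A : {fset H}.
Hypothesis A_gen : forall a : H, a \in A <-> exists i : int, a = g ^ i.

(** Since [g] has finite order, integer exponents may be replaced by natural
    ones. *)
Lemma powers_of_gP a : a \in A <-> exists m : nat, a = g ^+ m.
Proof.
split=> [/A_gen[[m|m] ->] | [m ->]].
- by exists m.
- exists (n.-1 * m.+1)%N.
  by rewrite NegzE -invr_expz -[g ^ m.+1]/(g ^+ m.+1) -exprVn taft_gV exprM.
- by apply/A_gen; exists m.
Qed.

Lemma powers_of_g_grouplike : is_grouplike_abelian hs A.
Proof.
split.
- by apply/powers_of_gP; exists 0%N.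
- move=> a b /powers_of_gP[i ->] /powers_of_gP[j ->]; apply/powers_of_gP.
  by exists (i + j)%N; rewrite exprD.
- move=> a /powers_of_gP[i ->]; apply/powers_of_gP; exists (n.-1 * i)%N.
  by rewrite -exprVn taft_gV exprM.
- move=> a b /powers_of_gP[i ->] /powers_of_gP[j ->].
  by rewrite -!exprD addnC.
- by move=> a /powers_of_gP[i ->]; apply: taft_grouplike_exp.
Qed.

End PowersOfg.

Section CoactionOnA1.
Variables (c : k) (K : falgType k) (y : K) (delta : 'Hom(K, tens H K)).
Hypothesis K_A1 : is_A1 n c g x y delta.

Let genK := A1_generated (A1_pres K_A1).

Lemma A1_is_comodule_algebra : is_comodule_algebra hs delta.
Proof.
have [d1 dM] := A1_coact K_A1; have dy := A1_coact_y K_A1.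
have [D1 DM] := taft_comul H_taft; have [e1 eM] := taft_counit H_taft.
have [DgV egV] := taft_grouplike_exp n.-1; rewrite -taft_gV in DgV egV.
split; first exact: A1_coact K_A1.
- apply: (coassociative_on_generators _ _ genK) => // u.
  rewrite inE => /eqP->; rewrite dy !linearB /= !tlift_pure // d1 dy.
  rewrite DgV taft_comul_xgV linearD linearB /= !tlift_pure //.
  by rewrite opprD addrA.
- apply: (counital_on_generators _ _ genK) => // u.
  rewrite inE => /eqP->; rewrite dy !linearB /= !tlift_pure //.
  by rewrite eM egV (taft_counit_x H_taft) mul0r scale0r scale1r subr0.
Qed.

End CoactionOnA1.

End Taft.

(** * The algebra generated by y with y^n = c *)

Lemma sum_expr_root (R : fieldType) n (z : R) :
  z ^+ n = 1 -> z != 1 -> \sum_(j < n) z ^+ j = 0.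
Proof.
move=> zn z1; have := subrX1 z n; rewrite zn subrr => /esym/eqP.
by rewrite mulf_eq0 subr_eq0 (negPf z1) => /eqP.
Qed.

(** The sum is over the cyclic group of order [n], so replacing [a] by [v * a]
    only shifts the summation index cyclically. *)
Lemma intertwining_average (R : pzRingType) n (u v : R) (f : R -> R) (a : R) :
    u ^+ n = 1 -> v ^+ n = 1 ->
  \sum_(m < n) u ^+ m * f (v ^+ (n - m) * (v * a)) =
  u * \sum_(m < n) u ^+ m * f (v ^+ (n - m) * a).
Proof.
(* Both sums are windows of length n of T, and T n = T 0. *)
move=> un vn; pose T m := u ^+ m * f (v ^+ (n.+1 - m) * a).
have -> : \sum_(m < n) u ^+ m * f (v ^+ (n - m) * (v * a)) = \sum_(m < n) T m.
  by apply: eq_bigr => m _; rewrite /T mulrA -exprSr subSn // ltnW.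
rewrite mulr_sumr.
have -> : \sum_(m < n) u * (u ^+ m * f (v ^+ (n - m) * a)) =
  \sum_(m < n) T m.+1 by apply: eq_bigr => m _; rewrite /T subSS exprS mulrA.
have T0n : T n = T 0%N.
  by rewrite /T un subSnn subn0 expr0 expr1 exprS vn mulr1.
apply: (@addIr _ (T n)); transitivity (\sum_(m < n.+1) T m).
  by rewrite big_ord_recr.
by rewrite big_ord_recl addrC T0n.
Qed.

Section AlgebraA1.
Variables (k : fieldType) (n : nat) (q b c : k).
Hypotheses (k_char0 : [pchar k] =i pred0) (q_prim : n.-primitive_root q).
Hypotheses (b_neq0 : b != 0) (b_root : b ^+ n = c).
Variables (K : falgType k) (y : K).
Hypothesis yn : y ^+ n = c%:A.
Hypothesis genK : generated_by [:: y].

Let n_gt0 : (0 < n)%N. Proof. exact: prim_order_gt0 q_prim. Qed.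

Let n_neq0 : n%:R != 0 :> k.
Proof. by rewrite ((pcharf0P k).1 k_char0) -lt0n. Qed.

Let q_neq0 : q != 0.
Proof. by rewrite (prim_root_eq0 q_prim) -lt0n. Qed.

Lemma A1_expand (a : K) : exists p : nat -> k, a = \sum_(m < n) p m *: y ^+ m.
Proof.
move: a; apply: (generated_ind genK) => [e a1 a2 [p1 ->] [p2 ->]||u a].
- exists (fun m => e * p1 m + p2 m); rewrite scaler_sumr -big_split /=.
  by apply: eq_bigr => m _; rewrite scalerA scalerDl.
- exists (fun m => (m == 0%N)%:R).
  rewrite (bigD1 (Ordinal n_gt0)) //= scale1r expr0 big1 ?addr0 // => m.
  by rewrite -val_eqE /= => /negPf->; rewrite scale0r.
- rewrite inE => /eqP-> [p ->].
  (* Multiplying by y shifts the coefficients, and y ^+ n = c wraps the last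
  one around to degree 0. *)
  exists (fun m => if m is m'.+1 then p m' else p n.-1 * c).
  case: n n_gt0 yn => // n' _ yn'.
  rewrite mulr_sumr big_ord_recr [RHS]big_ord_recl /= addrC; congr (_ + _).
    by rewrite -scalerAr -exprS yn' scalerA expr0.
  by apply: eq_bigr => m _; rewrite -scalerAr -exprS.
Qed.

(** Fourier inversion on Z/n: the n-th roots of unity [q ^+ m] and [q ^+ l] are
    distinct for distinct [m], [l] below [n], so all degrees but [l] cancel. *)
Lemma A1_component (p : nat -> k) l : (l < n)%N ->
  \sum_(j < n) (q ^- l) ^+ j *: (\sum_(m < n) (p m * (q ^+ j) ^+ m) *: y ^+ m) =
  (n%:R * p l) *: y ^+ l.
Proof.
move=> ln; under eq_bigr do rewrite scaler_sumr.
rewrite exchange_big /= (bigD1 (Ordinal ln)) //= [X in _ + X]big1 => [|m ml].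
  rewrite addr0 (eq_bigr (fun=> p l *: y ^+ l)) => [|j _] /=.
    by rewrite sumr_const card_ord -scaler_nat scalerA.
  rewrite scalerA mulrCA -!exprM mulnC exprVn -exprM mulnC mulVf ?mulr1 //.
  by rewrite expf_neq0.
under eq_bigr => j _.
  rewrite scalerA mulrCA -[(q ^+ j) ^+ m]exprM mulnC exprM -exprMn. over.
rewrite -scaler_suml -mulr_sumr sum_expr_root ?mulr0 ?scale0r //.
  by rewrite exprMn exprVn -!exprM !(mulnC _ n) !exprM (prim_expr_order q_prim)
    !expr1n invr1 mulr1.
apply: contra ml => /eqP qml.
have {qml}: q ^+ m = q ^+ l.
  have ql0 : q ^+ l != 0 by rewrite expf_neq0.
  by rewrite -[LHS]mul1r -(mulfV ql0) -mulrA qml mulr1.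
by move/eqP; rewrite (eq_prim_root_expr q_prim) !modn_small.
Qed.

(** Maschke: a linear projection onto the left ideal [I], averaged over the
    cyclic group generated by [y / b], is [K]-linear, and its kernel is a
    complementary left ideal. *)
Lemma A1_semisimple : semisimple_algebra K.
Proof.
move=> I idI; have [Y Yn yY] : exists2 Y, Y ^+ n = 1 & y = b *: Y.
  exists (b^-1 *: y); last by rewrite scalerA mulfV ?scale1r.
  by rewrite exprZn yn exprVn b_root scalerA mulVf ?scale1r // -b_root expf_neq0.
pose S a := \sum_(m < n) Y ^+ m * projv I (Y ^+ (n - m) * a).
have S_lin : linear S.
  move=> e s t; rewrite scaler_sumr -big_split; apply: eq_bigr => m _ /=.
  by rewrite mulrDr -scalerAr linearP /= mulrDr -scalerAr.
pose E : 'End(K) := linfun (fun a => n%:R^-1 *: S a).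
have EE a : E a = n%:R^-1 *: S a.
  rewrite linfunE_of // => e s t.
  by rewrite S_lin scalerDr !scalerA mulrC.
have E_in a : E a \in I.
  rewrite EE memvZ // memv_suml // => m _.
  by apply/idI/memv_proj.
have E_id a : a \in I -> E a = a.
  move=> aI; rewrite EE /S (eq_bigr (fun=> a)) => [|m _].
    by rewrite sumr_const card_ord -scaler_nat scalerA mulVf ?scale1r.
  rewrite projv_id; last exact: idI.
  by rewrite mulrA -exprD subnKC ?Yn ?mul1r // ltnW.
(* Commuting with Y is enough, as K is generated by y = b Y. *)
have EY a : E (Y * a) = Y * E a.
  rewrite !EE -[RHS]scalerAr; congr (_ *: _).
  exact: intertwining_average.
have E_mod r a : E (r * a) = r * E a.
  move: r; apply: (generated_ind genK) => [e r s er es||r s].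
  - by rewrite !mulrDl linearD /= -!scalerAl linearZ /= er es.
  - by rewrite !mul1r.
  - rewrite inE => /eqP-> es.
    by rewrite yY -!scalerAl linearZ /= -!mulrA EY es.
exists (lker E); split.
- by move=> r a; rewrite !memv_ker E_mod => /eqP->; rewrite mulr0.
- apply/eqP; rewrite eqEsubv subvf; apply/subvP => a _.
  rewrite -[a](subrK (E a)) addrC memv_add //.
  by rewrite memv_ker linearB /= (E_id (E a)) ?subrr.
- apply/eqP; rewrite -subv0; apply/subvP => a; rewrite memv_cap memv_ker.
  by move=> /andP[aI]; rewrite E_id // memv0.
Qed.

End AlgebraA1.

(** * Coinvariants and H-simplicity *)

Section CoactionOnA1.
Variables (k : fieldType) (k_char0 : [pchar k] =i pred0).
Variables (n : nat) (n_gt1 : (1 < n)%N) (q : k) (q_prim : n.-primitive_root q).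
Variables (b c : k) (b_neq0 : b != 0) (b_root : b ^+ n = c).
Variables (H : falgType k) (hs : hopf_ops H) (g x : H).
Hypothesis H_taft : is_taft n q hs g x.
Variables (K : falgType k) (y : K) (delta : 'Hom(K, tens H K)).
Hypothesis K_A1 : is_A1 n c g x y delta.

Let yn : y ^+ n = c%:A. Proof. by case: (A1_pres K_A1). Qed.
Let genK := A1_generated (A1_pres K_A1).

(** The form [chi] is the algebra map with [chi g = z^-1] and [chi x = 0], which
    kills the second term of [delta y]. *)
Lemma A1_twist (z : k) : z ^+ n = 1 ->
  exists chi : 'Hom(H, k^o), chi 1 = 1 /\
    forall m, tlift (fun h a => (chi h : k) *: a) (delta (y ^+ m)) =
              z ^+ m *: y ^+ m.
Proof.
move=> zn; have [_ univ] := taft_pres H_taft.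
have z0 : z != 0.
  by apply: contraTneq (oner_neq0 k) => z0; rewrite -zn z0 expr0n gtn_eqF ?eqxx // ltnW.
have rel : taft_relations n q (z^-1 : k^o) 0.
  split; first by rewrite expr0n gtn_eqF // ltnW.
    by rewrite exprVn zn invr1.
  by rewrite mulr0 mul0r scaler0.
have [f [fg fx _]] := univ _ _ _ rel.
have chiE h : linfun f h = f h by rewrite lfunE.
have fgV : f g^-1 = z.
  have gU := taft_unitg n_gt1 H_taft.
  by rewrite rmorphV //= fg invrK.
exists (linfun f); split=> [|m]; first by rewrite chiE rmorph1.
have [d1 dM] := A1_coact K_A1.
elim: m => [|m IHm].
  by rewrite !expr0 d1 tlift_pure // chiE rmorph1 !scale1r.
rewrite !exprS dM (tlift_tmul (mW := *%R)) // => [|u u' v v']; last first.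
  by rewrite !chiE rmorphM -scalerAl -scalerAr scalerA.
rewrite IHm (A1_coact_y K_A1) linearB /= !tlift_pure // !chiE rmorphM /= fx.
by rewrite mul0r scale0r subr0 fgV -scalerAl -scalerAr scalerA.
Qed.

(** A coinvariant is fixed by every twist, so [n] times it is the sum of its
    twists, which is concentrated in degree 0. *)
Lemma A1_trivial_coinvariants : trivial_coinvariants delta.
Proof.
have [d1 dM] := A1_coact K_A1.
move=> a; split=> [da|[z ->]]; last by rewrite !linearZ /= d1.
have [p ap] := A1_expand q_prim yn genK a.
have n0 : n%:R != 0 :> k by rewrite ((pcharf0P k).1 k_char0) -lt0n ltnW.
have twist j : \sum_(m < n) (p m * (q ^+ j) ^+ m) *: y ^+ m = a.
  have [|chi [chi1 chiy]] := A1_twist (z := q ^+ j).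
    by rewrite -exprM mulnC exprM (prim_expr_order q_prim) expr1n.
  have <- : tlift (fun h a => (chi h : k) *: a) (delta a) = a.
    by rewrite da tlift_pure // chi1 scale1r.
  rewrite ap !linear_sum; apply: eq_bigr => m _.
  by rewrite !linearZ /= chiy scalerA.
exists (p 0%N).
have := A1_component q_prim y p (ltnW n_gt1).
under eq_bigr => j _ do rewrite twist expr0 invr1 expr1n scale1r.
rewrite sumr_const card_ord -scaler_nat expr0 -scalerA.
by apply: scalerI.
Qed.

(** A nonzero stable ideal contains the homogeneous components of its elements,
    hence a power of the invertible element [y]. *)
Lemma A1_H_simple : H_simple delta.
Proof.
move=> I [idI _] coI; have [I0|] := eqVneq I 0%VS; [by left | right].
have n0 : n%:R != 0 :> k by rewrite ((pcharf0P k).1 k_char0) -lt0n ltnW.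
have c0 : c != 0 by rewrite -b_root expf_neq0.
have [a [aI a0]] : exists a, a \in I /\ a != 0.
  by exists (vpick I); rewrite memv_pick vpick0.
have [p ap] := A1_expand q_prim yn genK a.
have twist j : \sum_(m < n) (p m * (q ^+ j) ^+ m) *: y ^+ m \in I.
  have [|chi [chi1 chiy]] := A1_twist (z := q ^+ j).
    by rewrite -exprM mulnC exprM (prim_expr_order q_prim) expr1n.
  have -> : \sum_(m < n) (p m * (q ^+ j) ^+ m) *: y ^+ m =
    tlift (fun h a => (chi h : k) *: a) (delta a).
    rewrite ap !linear_sum; apply: eq_bigr => m _.
    by rewrite !linearZ /= chiy scalerA.
  by apply: tlift_tensv (coI _ aI) => // u v vI; rewrite memvZ.
have [l pl] : exists l : 'I_n, p l != 0.
  apply/existsP; apply: contraR a0 => /existsPn p0.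
  by rewrite ap big1 // => m _; move/negPn/eqP: (p0 m) => ->; rewrite scale0r.
have ylI : y ^+ l \in I.
  have := A1_component q_prim y p (ltn_ord l).
  move/esym/(canRL (scalerK (mulf_neq0 n0 pl))) => ->.
  by rewrite memvZ // memv_suml // => j _; rewrite memvZ.
have I1 : 1 \in I.
  rewrite -(scalerK c0 1) memvZ // -yn -(subnK (ltnW (ltn_ord l))) exprD.
  exact: idI.
apply/eqP; rewrite eqEsubv subvf; apply/subvP => r _.
by rewrite -[r]mulr1 idI.
Qed.

End CoactionOnA1.

(** * Conjugating g + beta x into g *)

(** Geometric series. *)
Lemma unitr_1_nilpotent (R : unitRingType) n (N : R) :
  N ^+ n = 0 -> 1 + N \is a GRing.unit.
Proof.
move=> Nn; pose M := - N; have Mn : M ^+ n = 0 by rewrite exprNn Nn mulr0.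
have -> : 1 + N = 1 - M by rewrite opprK.
have sumM : M * \sum_(i < n) M ^+ i = (\sum_(i < n) M ^+ i) * M.
  by rewrite mulr_sumr mulr_suml; apply: eq_bigr => i _; rewrite -exprS exprSr.
have M1 : (1 - M) * \sum_(i < n) M ^+ i = 1.
  by rewrite -opprB mulNr -subrX1 Mn sub0r opprK.
apply/unitrP; exists (\sum_(i < n) M ^+ i); split=> //.
by rewrite mulrBr mulr1 -sumM -{1}[\sum_(i < n) _]mul1r -mulrBl.
Qed.

Section Conjugation.
Variables (k : fieldType) (n : nat) (n_gt1 : (1 < n)%N).
Variables (q : k) (q_prim : n.-primitive_root q).
Variables (H : falgType k) (hs : hopf_ops H) (g x : H).
Hypothesis H_taft : is_taft n q hs g x.

Let gU := taft_unitg n_gt1 H_taft.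

Let z := x * g^-1.

Let xE : x = z * g. Proof. by rewrite /z divrK. Qed.

Lemma taft_g_skew m : g * z ^+ m = q ^+ m *: (z ^+ m * g).
Proof.
have gz : g * z = q *: (z * g).
  by rewrite -xE /z mulrA (taft_gx H_taft) -scalerAl mulrK.
elim: m => [|m IHm]; first by rewrite !expr0 scale1r mulr1 mul1r.
rewrite exprSr mulrA IHm -scalerAl -[z ^+ m * g * z]mulrA gz.
by rewrite -scalerAr scalerA [q ^+ m.+1]exprSr mulrA.
Qed.

(** [x] and [g^-1] commute up to a scalar, so [z ^+ n] is a left multiple of
    [x ^+ n]. *)
Lemma taft_skew_nilpotent : z ^+ n = 0.
Proof.
have xgV1 : x * g^-1 = q *: (g^-1 * x).
  apply: (mulrI gU); apply: (mulIr gU); rewrite -mulrA divrK //.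
  by rewrite -scalerAr mulVKr // -scalerAl (taft_gx H_taft).
have xgV m : x ^+ m * g^-1 = q ^+ m *: (g^-1 * x ^+ m).
  elim: m => [|m IHm]; first by rewrite !expr0 mulr1 mul1r scale1r.
  rewrite exprSr -mulrA xgV1 -scalerAr mulrA IHm -scalerAl scalerA -exprS.
  by rewrite -mulrA.
suff [r ->] : exists r, z ^+ n = r * x ^+ n by rewrite (taft_xn H_taft) mulr0.
elim: n => [|m [r IHm]]; first by exists 1; rewrite !expr0 mulr1.
exists (r * (q ^+ m.+1 *: g^-1)).
by rewrite exprSr IHm /z -mulrA [x ^+ m * _]mulrA -exprSr xgV -scalerAr mulrA
  -scalerAr -scalerAl.
Qed.

(** Writing [z] for [x * g^-1], a series [p] with coefficients [a_m] in [z]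
    satisfies [(1 + beta z) p(q z) = p(z)] when
    [(1 - q ^+ m.+1) a_m.+1 = beta q ^+ m a_m]: up to rescaling, these are the
    coefficients of a q-exponential. *)
Fixpoint qexp_coef (beta : k) m : k :=
  if m is m'.+1 then beta * q ^+ m' * qexp_coef beta m' / (1 - q ^+ m) else 1.

(** [g + beta x] is [(1 + beta z) g] and [g p(z) = p(q z) g], so the functional
    equation of the q-exponential gives the conjugation. The coefficients exist
    in degrees below [n] because [q ^+ m != 1] there, and [z ^+ n = 0] makes the
    truncation exact. The constant term is 1 and [z] is nilpotent, so [p] is a
    unit. *)
Lemma taft_conjugate_g (beta : k) :
  exists2 p, p \is a GRing.unit & (g + beta *: x) * p = p * g.
Proof.
pose a := qexp_coef beta; exists (\sum_(m < n) a m *: z ^+ m).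
  case: n n_gt1 taft_skew_nilpotent => // n' _ zn.
  rewrite big_ord_recl /= scale1r expr0.
  pose w := \sum_(m < n') a m.+1 *: z ^+ m.
  have -> : \sum_(m < n') a (bump 0 m) *: z ^+ bump 0 m = z * w.
    by rewrite mulr_sumr; apply: eq_bigr => m _; rewrite -scalerAr -exprS.
  apply: (@unitr_1_nilpotent _ n'.+1); rewrite exprMn_comm ?zn ?mul0r //.
  rewrite /GRing.comm mulr_sumr mulr_suml; apply: eq_bigr => m _.
  by rewrite -scalerAr -scalerAl -exprS exprSr.
have -> : (g + beta *: x) * (\sum_(m < n) a m *: z ^+ m) =
  (\sum_(m < n) (a m * q ^+ m) *: z ^+ m +
   \sum_(m < n) (beta * q ^+ m * a m) *: z ^+ m.+1) * g.
  rewrite mulrDl mulrDl !mulr_sumr !mulr_suml; congr (_ + _); apply: eq_bigr => m _.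
    by rewrite -scalerAr taft_g_skew scalerA scalerAl.
  have xz : x * z ^+ m = q ^+ m *: (z ^+ m.+1 * g).
    by rewrite {1}xE -(mulrA z) taft_g_skew -scalerAr mulrA -exprS.
  by rewrite -scalerAl -scalerAr xz !scalerA scalerAl mulrAC.
congr (_ * g); apply/esym/eqP; rewrite addrC -subr_eq -sumrB.
apply/eqP; case: n q_prim taft_skew_nilpotent => [|n'] qn zn.
  by rewrite !big_ord0.
rewrite big_ord_recl [RHS]big_ord_recr /= zn scaler0 addr0 -scalerBl.
rewrite expr0 mulr1 subrr scale0r add0r; apply: eq_bigr => m _.
rewrite -scalerBl -{1}[a _]mulr1 -mulrBr /bump /= add1n divfK //.
rewrite subr_eq0 eq_sym -(expr0 q) (eq_prim_root_expr qn) modn_small ?mod0n //.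
by rewrite ltnS.
Qed.

End Conjugation.

(** * Translations and convolution on the dual *)

Section DualSpace.
Variables (k : fieldType) (H : falgType k) (hs : hopf_ops H).

(** Left translation by [a]; the action [dual_lact] of [h] is [translate] by the
    preimage of [h] under the antipode. *)
Definition translate (a : H) (xi : dual H) : dual H :=
  linfun (fun t => xi (a * t)).

Lemma translateE a xi t : translate a xi t = xi (a * t).
Proof. by apply: linfunE_of => e u v; rewrite mulrDr -scalerAr linearP. Qed.

Lemma dual_ractE a (xi : dual H) t : dual_ract a xi t = xi (t * a).
Proof. by apply: linfunE_of => e u v; rewrite mulrDl -scalerAl linearP. Qed.

Lemma translate_bilinear : bilinear_map translate.
Proof.
split=> [xi|a] e s t; apply/lfunP=> h; rewrite add_lfunE scale_lfunE !translateE.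
  by rewrite mulrDl -scalerAl linearP.
by rewrite add_lfunE scale_lfunE.
Qed.

Lemma dual_ract_linear a : linear (@dual_ract k H a).
Proof.
move=> e s t; apply/lfunP=> h; rewrite add_lfunE scale_lfunE !dual_ractE.
by rewrite add_lfunE scale_lfunE.
Qed.

Lemma form_mul_bilinear (gamma xi : dual H) :
  bilinear_map (fun a b : H => gamma a * xi b : k^o).
Proof.
by split=> w a s t /=; rewrite linearP ?mulrDl ?mulrDr -?scalerAl -?scalerAr.
Qed.

Lemma convE gamma xi h :
  conv hs gamma xi h = tlift (fun a b => gamma a * xi b : k^o) (comul hs h).
Proof. by apply: linfunE_of => e u v; rewrite !linearP. Qed.

Lemma conv_bilinear : bilinear_map (conv hs).
Proof.
split=> [xi|gamma] e s t; apply/lfunP=> h; rewrite add_lfunE scale_lfunE !convE.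
- apply: (tlift_param_linear (beta := fun (r : dual H) a b => r a * xi b : k^o)).
  by move=> u v d r r'; rewrite add_lfunE scale_lfunE mulrDl -scalerAl.
- apply: (tlift_param_linear (beta := fun (r : dual H) a b => gamma a * r b : k^o)).
  by move=> u v d r r'; rewrite add_lfunE scale_lfunE mulrDr -scalerAr.
Qed.

Lemma tlift_tmul_pure (W : vectType k) (beta : H -> H -> W) a b t :
    bilinear_map beta ->
  tlift beta (tmul (a \ot b) t) = tlift (fun u v => beta (a * u) (b * v)) t.
Proof.
move=> bb; have [_ rm] := @tmul_bilinear k H H.
move: t; apply: eq_on_pure => [e s t|e s t|u v].
- by rewrite rm !(tlift_is_linear _ e).
- by rewrite !(tlift_is_linear _ e).
- rewrite tmul_pure !tlift_pure //.
  split=> w e s t /=; first by rewrite mulrDr -scalerAr bb.1.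
  by rewrite mulrDr -scalerAr bb.2.
Qed.

(** [gamma(a h_1) xi(b h_2)] is again a convolution: this is how a coproduct
    [a (x) b] acts on a convolution product. *)
Lemma translate_conv (a b h : H) (gamma xi : dual H) :
  tlift (fun u v => gamma u * xi v : k^o) (tmul (a \ot b) (comul hs h)) =
  conv hs (translate a gamma) (translate b xi) h.
Proof.
rewrite convE tlift_tmul_pure; last exact: form_mul_bilinear.
by apply: eq_tlift => u v; rewrite !translateE.
Qed.

Lemma conv_counit (gamma : dual H) : is_hopf hs -> conv hs gamma (counit hs) = gamma.
Proof.
move=> hopf; apply/lfunP=> h; rewrite convE -{2}(counitr hopf h).
move: (comul hs h); apply: eq_on_pure => [e s t|e s t|u v].
- exact: tlift_is_linear.
- by rewrite !linearP.
- rewrite !tlift_pure //; last exact: form_mul_bilinear.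
  by rewrite linearZ /= mulrC.
Qed.

End DualSpace.

Section TaftDual.
Variables (k : fieldType) (n : nat) (n_gt1 : (1 < n)%N) (q : k).
Variables (H : falgType k) (hs : hopf_ops H) (g x : H).
Hypothesis H_taft : is_taft n q hs g x.

Lemma translate_g_conv gamma xi :
  translate g (conv hs gamma xi) =
  conv hs (translate g gamma) (translate g xi).
Proof.
apply/lfunP=> h; rewrite translateE convE (taft_comulM H_taft).
by rewrite (taft_comul_g H_taft) translate_conv.
Qed.

Lemma translate1 (xi : dual H) : translate 1 xi = xi.
Proof. by apply/lfunP=> h; rewrite translateE mul1r. Qed.

Lemma translate_x_conv gamma xi :
  translate x (conv hs gamma xi) =
  conv hs gamma (translate x xi) + conv hs (translate x gamma) (translate g xi).
Proof.
apply/lfunP=> h; rewrite translateE convE (taft_comulM H_taft).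
have [lm _] := @tmul_bilinear k H H.
rewrite (taft_comul_x H_taft) -[1 \ot x]scale1r lm scale1r linearD /=.
by rewrite !translate_conv add_lfunE translate1.
Qed.

Lemma dual_lact_gV (xi : dual H) : dual_lact hs g^-1 xi = translate g xi.
Proof.
rewrite /dual_lact (taft_antipode_inv n_gt1 H_taft (a := g)) //.
exact: taft_antipode_g H_taft.
Qed.

Lemma dual_lact_xgV (xi : dual H) :
  dual_lact hs (x * g^-1) xi = - translate x xi.
Proof.
rewrite /dual_lact (taft_antipode_inv n_gt1 H_taft (a := - x)); last first.
  by rewrite linearN /= (taft_antipode_x H_taft) opprK.
apply/lfunP => h; rewrite -/(translate _ _) opp_lfunE !translateE.
by rewrite mulNr linearN.
Qed.

End TaftDual.

(** * One-dimensional modules and the action on the dual tensor space *)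

Lemma line_coordinate (k : fieldType) (V : vectType k) (v : V) :
    v != 0 -> <[v]>%VS = fullv ->
  exists phi : 'Hom(V, k^o), phi v = 1 /\ forall u, u = (phi u : k) *: v.
Proof.
move=> v0 full; pose phi : 'Hom(V, k^o) := linfun (coord [tuple v] ord0 : V -> k^o).
have phiE u : phi u = coord [tuple v] ord0 u by rewrite lfunE.
have phiK u : u = (phi u : k) *: v.
  rewrite phiE; have : u \in <<[tuple v]>>%VS by rewrite span_seq1 full memvf.
  by move=> /coord_span {1}->; rewrite big_ord1.
exists phi; split=> //; have := phiK v; rewrite -[v in LHS]scale1r.
by move/eqP; rewrite -subr_eq0 -scalerBl scaler_eq0 (negPf v0) orbF subr_eq0 => /eqP.
Qed.

Lemma line_irreducible (k : fieldType) (K : falgType k) (V : kmodule K) (v : V) :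
  v != 0 -> <[v]>%VS = {:V}%VS -> irreducible_module V.
Proof.
move=> v0 full; split.
  by move=> V0; have := memvf v; rewrite V0 memv0 (negPf v0).
have [phi [_ phiK]] := line_coordinate v0 full.
move=> U _; have [U0|U0] := eqVneq U 0%VS; [by left | right].
apply/eqP; rewrite eqEsubv subvf -full -memvE.
have pU := memv_pick U; have p0 : vpick U != 0 by rewrite vpick0.
have phi0 : (phi (vpick U) : k) != 0.
  by apply: contraNneq p0 => e; rewrite [vpick U]phiK e scale0r.
by rewrite -(scalerK phi0 v) -phiK memvZ.
Qed.

Section DualModule.
Variables (k : fieldType) (H : falgType k) (hs : hopf_ops H).
Variables (K : falgType k) (delta : 'Hom(K, tens H K)).
Hypothesis delta_algebra_map : is_algebra_map (1 \ot 1) (@tmul k H K) delta.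
Hypothesis invS1 : ((antipode hs)^-1)%VF 1 = 1.
Hypothesis invSM : forall a b, ((antipode hs)^-1)%VF (a * b) =
  ((antipode hs)^-1)%VF b * ((antipode hs)^-1)%VF a.

Variable V : kmodule K.

Let act (t : tens H K) (F : tens (dual H) V) : tens (dual H) V :=
  tlift (fun h a => tlift (fun gamma v => dual_lact hs h gamma \ot mact V a v) F) t.

Lemma dual_lact_bilinear : bilinear_map (dual_lact hs).
Proof.
split=> w e s t; rewrite /dual_lact -!/(translate _ _).
  by rewrite linearP (translate_bilinear H).1.
exact: (translate_bilinear H).2.
Qed.

Lemma dual_lact_mact_bilinear h a :
  bilinear_map (fun gamma v => dual_lact hs h gamma \ot mact V a v).
Proof.
split=> w e s t /=; last by rewrite !linearP.
by rewrite dual_lact_bilinear.2 ptens_linearl.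
Qed.

Let act_inner_bilinear F : bilinear_map (fun h a =>
  tlift (fun gamma v => dual_lact hs h gamma \ot mact V a v) F).
Proof.
split=> w; apply: tlift_param_linear => gamma v e s t.
  by rewrite dual_lact_bilinear.1 ptens_linearl.
by rewrite linearP add_lfunE scale_lfunE linearP.
Qed.

Let act_bilinear : bilinear_map act.
Proof.
split=> [F|t]; first exact: tlift_is_linear.
by apply: tlift_param_linear => h a; apply: tlift_is_linear.
Qed.

Lemma dtens_act_linearl F : linear (fun a => dtens_act hs delta (V := V) a F).
Proof. by move=> e a b; rewrite /dtens_act !linearP. Qed.

Lemma dtens_act_linear a : linear (dtens_act hs delta (V := V) a).
Proof. exact: act_bilinear.2. Qed.

Lemma dtens_act1 F : dtens_act hs delta (V := V) 1 F = F.
Proof.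
have [d1 _] := delta_algebra_map; rewrite -[LHS]/(act _ F) d1.
move: F; apply: eq_on_pure => [||gamma v].
- exact: act_bilinear.2.
- by move=> e s t.
- rewrite /act !tlift_pure //; last exact: dual_lact_mact_bilinear.
  rewrite mact1 /dual_lact invS1; congr (_ \ot _).
  exact: translate1.
Qed.

(** The action on the dual is a left action because the inverse antipode
    reverses products; hence commuting with [y] will imply commuting with [K]. *)
Lemma dtens_actM a b F : dtens_act hs delta (V := V) (a * b) F =
  dtens_act hs delta a (dtens_act hs delta b F).
Proof.
have [_ dM] := delta_algebra_map; rewrite -[LHS]/(act _ F) dM.
rewrite -[RHS]/(act _ (act _ F)); move: (delta a) (delta b) => s t.
have [lm rm] := @tmul_bilinear k H K; have [la ra] := act_bilinear.
elim/tens_ind: s => [e s s' es es'|h u]; first by rewrite lm !la es es'.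
elim/tens_ind: t => [e t t' et et'|h' u']; first by rewrite rm !la ra et et'.
elim/tens_ind: F => [e F F' eF eF'|gamma v]; first by rewrite !ra eF eF'.
have bl := dual_lact_mact_bilinear.
rewrite tmul_pure /act !tlift_pure // mactM; congr (_ \ot _).
apply/lfunP => r; rewrite /dual_lact -!/(translate _ _) !translateE invSM.
by rewrite mulrA.
Qed.

Lemma dtens_act_pure y h1 u1 h2 u2 gamma v :
    delta y = h1 \ot u1 - h2 \ot u2 ->
  dtens_act hs delta (V := V) y (gamma \ot v) =
  dual_lact hs h1 gamma \ot mact V u1 v - dual_lact hs h2 gamma \ot mact V u2 v.
Proof.
move=> dy; rewrite /dtens_act dy linearB /= !tlift_pure //;
  exact: dual_lact_mact_bilinear.
Qed.

End DualModule.

Section DualCommute.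
Variables (k : fieldType) (H : falgType k) (hs : hopf_ops H).
Variables (K : falgType k) (delta : 'Hom(K, tens H K)) (V W : kmodule K).

Lemma stabLE (G : tens (dual H) 'Hom(V, W)) (F : tens (dual H) V) :
  stabL hs V W G F = tlift (fun gamma (T : 'Hom(V, W)) =>
      tlift (fun xi v => conv hs gamma xi \ot T v) F) G.
Proof.
have in_lin G' : linear (fun F => tlift (fun gamma (T : 'Hom(V, W)) =>
    tlift (fun xi v => conv hs gamma xi \ot T v) F) G').
  by apply: tlift_param_linear => gamma T; apply: tlift_is_linear.
rewrite /stabL linfunE_of ?linfunE_of // => e s t; apply/lfunP => F'.
by rewrite add_lfunE scale_lfunE !linfunE_of // tlift_is_linear.
Qed.

Lemma stabL_pure gamma (T : 'Hom(V, W)) xi (v : V) :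
  stabL hs V W (gamma \ot T) (xi \ot v) = conv hs gamma xi \ot T v.
Proof.
rewrite stabLE !tlift_pure //.
  split=> w e s t /=; last by rewrite !linearP.
  by rewrite (conv_bilinear hs).2 ptens_linearl.
split=> w; apply: tlift_param_linear => r u e s t.
  by rewrite (conv_bilinear hs).1 ptens_linearl.
by rewrite add_lfunE scale_lfunE linearP.
Qed.

Lemma dtens_ract_pure (h : H) (gamma : dual H) (T : 'Hom(V, W)) :
  dtens_ract (V := V) (W := W) h (gamma \ot T) = dual_ract h gamma \ot T.
Proof.
rewrite /dtens_ract tlift_pure //; split=> w e s t /=; last by rewrite linearP.
by rewrite dual_ract_linear ptens_linearl.
Qed.

End DualCommute.

(** * Stabilizers of one-dimensional modules *)

Section StabilizerOfLines.
Variables (k : fieldType) (n : nat) (n_gt1 : (1 < n)%N).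
Variables (q : k) (q_prim : n.-primitive_root q).
Variables (H : falgType k) (hs : hopf_ops H) (g x : H).
Hypothesis H_taft : is_taft n q hs g x.
Variables (c : k) (K : falgType k) (y : K) (delta : 'Hom(K, tens H K)).
Hypothesis K_A1 : is_A1 n c g x y delta.
Variables (V W : kmodule K) (v0 : V) (w0 : W) (s r : k).
Hypotheses (v0_neq0 : v0 != 0) (v0_full : <[v0]>%VS = fullv).
Hypotheses (w0_neq0 : w0 != 0) (w0_full : <[w0]>%VS = fullv).
Hypotheses (yv0 : mact V y v0 = s *: v0) (yw0 : mact W y w0 = r *: w0).

Let hopfH := taft_is_hopf n_gt1 H_taft.

Lemma line_eigen (U : kmodule K) (u0 : U) e : u0 != 0 -> <[u0]>%VS = fullv ->
  mact U y u0 = e *: u0 -> forall u, mact U y u = e *: u.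
Proof.
move=> u00 full yu u; have [phi [_ phiK]] := line_coordinate u00 full.
by rewrite (phiK u) linearZ /= yu !scalerA mulrC.
Qed.

Lemma dtens_act_y_line (U : kmodule K) (u0 : U) e :
    u0 != 0 -> <[u0]>%VS = fullv -> mact U y u0 = e *: u0 ->
  forall (xi : dual H) u, dtens_act hs delta (V := U) y (xi \ot u) =
    (e *: translate g xi + translate x xi) \ot u.
Proof.
move=> u00 full yu xi u; rewrite (dtens_act_pure _ _ _ (A1_coact_y K_A1)).
rewrite (dual_lact_gV n_gt1 H_taft) (dual_lact_xgV n_gt1 H_taft) mact1.
rewrite (line_eigen u00 full yu) linearZ /= ptensNl opprK ptensDl ptensZl.
by [].
Qed.

(** Both actions are actions of the algebra [K], which [y] generates. *)
Lemma commute_with_y (F : 'Hom(tens (dual H) V, tens (dual H) W)) :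
    (forall X, F (dtens_act hs delta (V := V) y X) = dtens_act hs delta (V := W) y (F X)) ->
  forall a X, F (dtens_act hs delta (V := V) a X) = dtens_act hs delta (V := W) a (F X).
Proof.
have dA := A1_coact K_A1.
have invS1 : ((antipode hs)^-1)%VF 1 = 1.
  apply: (taft_antipode_inv n_gt1 H_taft).
  exact: algebra_map1 (taft_antipode H_taft).
have invSM := taft_antipode_invM n_gt1 H_taft.
move=> Fy; apply: (generated_ind (A1_generated (A1_pres K_A1))).
- move=> e a b Fa Fb X.
  by rewrite !(dtens_act_linearl hs delta _ e) linearP /= Fa Fb.
- by move=> X; rewrite !dtens_act1.
- move=> u a; rewrite inE => /eqP-> Fa X.
  by rewrite !dtens_actM // Fy Fa.
Qed.

(** Since the coproduct of [x] is [1 (x) x + x (x) g], the terms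
    [gamma(t_1) xi(x t_2)] cancel in the commutator with [y], which is therefore
    convolution by [s gamma - r gamma(g _) - gamma(x _)] after translation of [xi]
    by [g]. Choosing [xi] so that the translate is the counit shows that this form
    must vanish. *)
Lemma stab_pureP (gamma : dual H) (T0 : 'Hom(V, W)) : T0 v0 = w0 ->
  stab hs delta (stabL hs V W (gamma \ot T0)) <->
  s *: gamma = r *: translate g gamma + translate x gamma.
Proof.
move=> T0v; set F := stabL _ _ _ _.
pose P := s *: gamma - r *: translate g gamma - translate x gamma.
have cb := conv_bilinear hs; have [cl cr] := cb.
have diff xi v : F (dtens_act hs delta (V := V) y (xi \ot v)) -
    dtens_act hs delta (V := W) y (F (xi \ot v)) =
    conv hs P (translate g xi) \ot T0 v.
  rewrite /F (dtens_act_y_line v0_neq0 v0_full yv0) !stabL_pure.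
  rewrite (dtens_act_y_line w0_neq0 w0_full yw0) -ptensNl -ptensDl.
  congr (_ \ot _); rewrite (translate_g_conv H_taft) (translate_x_conv H_taft).
  rewrite cr /P !(bilinearDl cb, bilinearNl cb, bilinearZl cb).
  rewrite [conv hs gamma (translate x xi) + conv _ _ _]addrC.
  by rewrite [r *: _ + _]addrA opprD addrACA subrr addr0 opprD addrA.
have -> : s *: gamma = r *: translate g gamma + translate x gamma <-> P = 0.
  rewrite /P -addrA -opprD; split=> [->|/eqP]; first by rewrite subrr.
  by rewrite subr_eq0 => /eqP.
split=> [[Fcomm _]|P0].
  (* The convolution unit is the counit, so this choice of xi recovers the
  form itself. *)
  have := diff (translate g^-1 (counit hs)) v0; rewrite Fcomm subrr T0v.
  have -> : translate g (translate g^-1 (counit hs)) = counit hs.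
    apply/lfunP => h; rewrite !translateE mulKr //.
    exact (taft_unitg n_gt1 H_taft).
  rewrite conv_counit // => /esym P0.
  have [phi [phi1 _]] := line_coordinate w0_neq0 w0_full.
  have := congr1 (tlift (fun (xi : dual H) w => (phi w : k) *: xi)) P0.
  by rewrite tlift_pure ?phi1 ?scale1r ?linear0 //; apply: scale_form_bilinear.
split; last by apply: memv_img; rewrite memvf.
apply: commute_with_y; apply: eq_on_pure => [e X Y|e X Y|xi v].
- by rewrite dtens_act_linear linearP.
- by rewrite linearP /= dtens_act_linear.
- apply/eqP; rewrite -subr_eq0 diff P0.
  by rewrite (bilinear0l cb) ptens0l.
Qed.

Hypothesis r_neq0 : r != 0.

(** The isomorphism sends convolution by [gamma] to [gamma(p _)], where [p]
    conjugates [g + x / r] into [g]; it is evidently invertible and commutes with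
    right translations. *)
Lemma stab_line_iso (Q : dual H -> Prop) :
    (forall f, Q f <-> forall t, f (g * t) = s / r * f t) ->
  submod_iso (stab hs delta (V := V) (W := W)) (stab_act hs (V := V) (W := W))
    Q (@dual_ract k H).
Proof.
move=> QP.
have [phi [phi1 phiK]] := line_coordinate v0_neq0 v0_full.
have [psi [psi1 psiK]] := line_coordinate w0_neq0 w0_full.
pose T0 : 'Hom(V, W) := linfun (fun v => (phi v : k) *: w0).
have T0E v : T0 v = (phi v : k) *: w0.
  by apply: linfunE_of => e u u'; rewrite linearP scalerDl scalerA.
have T0v : T0 v0 = w0 by rewrite T0E phi1 scale1r.
(* T0 spans Hom(V, W), and ev is the resulting identification of
the tensors with the dual of H. *)
pose ev (G : tens (dual H) 'Hom(V, W)) : dual H :=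
  tlift (fun gamma (T : 'Hom(V, W)) => (psi (T v0) : k) *: gamma) G.
have evb : bilinear_map (fun (gamma : dual H) (T : 'Hom(V, W)) =>
    (psi (T v0) : k) *: gamma).
  split=> [T|gamma] e a b /=; first by rewrite scalerDr !scalerA mulrC.
  by rewrite add_lfunE scale_lfunE linearP scalerDl scalerA.
have ev_pure gamma : ev (gamma \ot T0) = gamma.
  by rewrite /ev tlift_pure // T0v psi1 scale1r.
have evK G : ev G \ot T0 = G.
  move: G; apply: eq_on_pure => [e G G'|e G G'|gamma T] //.
    by rewrite /ev linearP ptens_linearl.
  rewrite /ev tlift_pure // ptensZl -linearZ /=; congr (_ \ot _).
  apply/lfunP => v; have -> : T v = (phi v : k) *: T v0.
    by rewrite -linearZ /= -phiK.
  by rewrite scale_lfunE T0E {2}[T v0]psiK !scalerA mulrC.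
have stabLK G : ((stabL hs V W)^-1)%VF (stabL hs V W G) = G.
  apply: lker0_lfunK; rewrite -subv0; apply/subvP => G'.
  rewrite memv_ker memv0 -(evK G') => /eqP L0; apply/eqP.
  have := congr1 (fun F : 'Hom(_, _) => F (counit hs \ot v0)) L0.
  rewrite /= stabL_pure T0v conv_counit // zero_lfunE => e0.
  have := congr1 (tlift (fun (xi : dual H) w => (psi w : k) *: xi)) e0.
  rewrite tlift_pure ?psi1 ?scale1r ?linear0 //.
  by move=> ->; rewrite ptens0l.
have stabP F : stab hs delta F -> exists2 gamma : dual H,
    F = stabL hs V W (gamma \ot T0) &
    s *: gamma = r *: translate g gamma + translate x gamma.
  move=> sF; have [_ /memv_imgP[G _ FG]] := sF.
  by exists (ev G); [rewrite evK | apply/(stab_pureP (ev G) T0v); rewrite evK -FG].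
have stab_act_pure h gamma : stab_act hs h (stabL hs V W (gamma \ot T0)) =
    stabL hs V W (dual_ract h gamma \ot T0).
  by rewrite /stab_act stabLK dtens_ract_pure.
have [p pU gp] := taft_conjugate_g n_gt1 q_prim H_taft r^-1.
have eigen gamma : s *: gamma = r *: translate g gamma + translate x gamma <->
    forall t, gamma ((g + r^-1 *: x) * t) = s / r * gamma t.
  split=> [e t | e].
    have := congr1 (fun f : dual H => r^-1 *: f t) e.
    rewrite /= !(add_lfunE, scale_lfunE) !translateE scalerDr !scalerA.
    rewrite mulVf // scale1r [_ * s]mulrC => es.
    by rewrite mulrDl linearD -scalerAl linearZ /= -es.
  apply/lfunP => t; rewrite !(add_lfunE, scale_lfunE) !translateE.
  have := congr1 (fun z : k^o => r *: z) (e t).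
  rewrite /= mulrDl linearD -scalerAl linearZ /= scalerDr scalerA mulfV //.
  rewrite scale1r => ->; rewrite -[LHS]/(s * _) -[RHS]/(r * _).
  by rewrite mulrA mulrCA mulfV ?mulr1.
split.
- move=> h F /stabP[gamma -> sg]; rewrite stab_act_pure.
  apply/(stab_pureP _ T0v)/eigen => t; rewrite !dual_ractE -[_ * t * h]mulrA.
  by rewrite (eigen gamma).1.
- move=> h f /QP Qf; apply/QP => t; rewrite !dual_ractE -[g * t * h]mulrA.
  exact: Qf.
pose Phi : 'Hom('Hom(tens (dual H) V, tens (dual H) W), dual H) :=
  linfun (fun F => translate p (ev (((stabL hs V W)^-1)%VF F))).
have PhiE gamma : Phi (stabL hs V W (gamma \ot T0)) = translate p gamma.
  rewrite /Phi linfunE_of ?stabLK ?ev_pure // => e F F'.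
  by rewrite /ev !linearP (translate_bilinear H).2.
exists Phi; split.
- move=> F /stabP[gamma -> /eigen sg]; rewrite PhiE; apply/QP => t.
  by rewrite !translateE mulrA -gp -mulrA sg.
- move=> F1 F2 /stabP[g1 -> _] /stabP[g2 -> _]; rewrite !PhiE => e.
  suff -> : g1 = g2 by [].
  apply/lfunP => t; have := congr1 (fun f : dual H => f (p^-1 * t)) e.
  by rewrite /= !translateE mulVKr.
- move=> f /QP Qf; exists (stabL hs V W (translate p^-1 f \ot T0)).
    apply/(stab_pureP _ T0v)/eigen => t; rewrite !translateE -Qf.
    by rewrite !mulrA; congr (f (_ * t)); apply: (mulIr pU); rewrite divrK // -mulrA gp mulKr.
  by rewrite PhiE; apply/lfunP => t; rewrite !translateE mulKr.
- move=> h F /stabP[gamma -> _]; rewrite stab_act_pure !PhiE.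
  by apply/lfunP => t; rewrite !(translateE, dual_ractE) mulrA.
Qed.

End StabilizerOfLines.

(** * Characters of the group of powers of g *)

Section Characters.
Variables (k : fieldType) (H : falgType k) (g : H) (A : {fset H}).
Hypothesis A_powers : forall a : H, a \in A <-> exists m : nat, a = g ^+ m.
Variable ga : A.
Hypothesis gaE : val ga = g.

(** [is_character] only constrains values on triples of elements of [A], so
    powers are treated by induction. *)
Lemma character_exp (chi : character A) (a : A) m :
  val a = g ^+ m -> chi a = chi ga ^+ m.
Proof.
have /andP[/forallP chi1 /forallP chiM] := char_funP chi.
elim: m a => [|m IHm] a am.
  by apply/eqP/(implyP (chi1 a)); rewrite am.
have gmA : g ^+ m \in A by apply/A_powers; exists m.
pose a' : A := FSetSub gmA.
rewrite exprS -(IHm a') //; apply/eqP.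
apply: (implyP (forallP (forallP (chiM ga) a') a)).
by rewrite am exprS gaE.
Qed.

Lemma char_space_powers (chi : character A) (f : dual H) :
  char_space chi f <-> forall t, f (g * t) = chi ga * f t.
Proof.
split=> [cf t|cf a t]; first by rewrite -gaE cf.
have /A_powers[m am] := valP a.
rewrite (character_exp chi am) am; elim: m {am} t => [|m IHm] t.
  by rewrite !expr0 !mul1r.
by rewrite !exprS -!mulrA cf IHm.
Qed.

End Characters.

Theorem proposition4p2 (k : closedFieldType) (k_char0 : [pchar k] =i pred0)
    (n : nat) (n_ge2 : (2 <= n)%N) (q : k) (q_prim : n.-primitive_root q)
    (c b : k) (c_neq0 : c != 0) (b_neq0 : b != 0) (b_root : b ^+ n = c)
    (H : falgType k) (hs : hopf_ops H) (g x : H) (H_taft : is_taft n q hs g x)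
    (A : {fset H}) (A_gen : forall a : H, a \in A <-> exists i : int, a = g ^ i)
    (K : falgType k) (y : K) (delta : 'Hom(K, tens H K))
    (K_A1 : is_A1 n c g x y delta)
    (V : character A -> kmodule K)
    (V_chi : forall (i : 'I_n) (chi : character A),
       (forall a : A, val a = g -> chi a = q ^+ i) ->
       exists v : V chi,
         [/\ v != 0, <[v]>%VS = {:V chi}%VS
           & mact (V chi) y v = (q ^+ i * b) *: v]) :
  is_dynamical_datum hs delta V.
Proof.
have A_powers := powers_of_gP n_ge2 H_taft A_gen.
have gA : g \in A by apply/A_powers; exists 1%N.
pose ga : A := FSetSub gA; have gaE : val ga = g by [].
have chin (chi : character A) : chi ga ^+ n = 1.
  have oneA : 1 \in A by apply/A_powers; exists 0%N.
  rewrite -(character_exp A_powers gaE chi (a := FSetSub oneA) (m := n)).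
    by rewrite (character_exp A_powers gaE chi (m := 0)).
  by rewrite (taft_gn H_taft).
have vec chi : exists v : V chi,
    [/\ v != 0, <[v]>%VS = {:V chi}%VS & mact (V chi) y v = (chi ga * b) *: v].
  have [i chii] := prim_rootP q_prim (chin chi).
  rewrite chii; apply: V_chi => a ag.
  by rewrite -chii -(expr1 (chi ga)); apply: (character_exp A_powers gaE).
have yn : y ^+ n = c%:A by case: (A1_pres K_A1).
split.
- exact (taft_is_hopf n_ge2 H_taft).
- exact (powers_of_g_grouplike n_ge2 H_taft A_gen).
- exact (A1_is_comodule_algebra n_ge2 H_taft K_A1).
- exact (A1_H_simple k_char0 n_ge2 q_prim b_neq0 b_root H_taft K_A1).
- exact (A1_semisimple k_char0 q_prim b_neq0 b_root yn
    (A1_generated (A1_pres K_A1))).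
- exact (A1_trivial_coinvariants k_char0 n_ge2 q_prim H_taft K_A1).
- by move=> chi; have [v [v0 vfull _]] := vec chi; apply: line_irreducible vfull.
- move=> chi mu.
  have [v [v0 vfull yv]] := vec chi; have [w [w0 wfull yw]] := vec mu.
  have mu0 : mu ga * b != 0.
    rewrite mulf_neq0 //; apply: contraTneq (oner_neq0 k) => mu0.
    by rewrite -(chin mu) mu0 expr0n gtn_eqF ?eqxx // ltnW.
  apply: (stab_line_iso n_ge2 q_prim H_taft K_A1 v0 vfull w0 wfull yv yw mu0).
  move=> f; rewrite (char_space_powers A_powers gaE) ffunE -mulf_div divff // mulr1.
  by [].
Qed.
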